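(* Let $\Lambda\subset\mathbb Z$ be a finite interval, $X,Y\subset\Lambda$ subintervals with $\operatorname{dist}(X,Y)\ge20$, $R\in\mathcal R_\Lambda$ a root tiling, $\lambda\in\mathbb C\setminus\{0\}$ and $\kappa>0$. Then for all even observables $A_1\in\mathcal A^e_X$, $A_2\in\mathcal A^e_Y$, $$\big|\omega^\Lambda_R(A_1A_2)-\omega^\Lambda_R(A_1)\,\omega^\Lambda_R(A_2)\big|\le8\|A_1\|\|A_2\|\,e^{-c(\lambda)(\operatorname{dist}(X,Y)-20)/2},$$ where $c(\lambda)=\frac13\ln\frac{\sqrt{4|\lambda|^2+1}+1}{\sqrt{4|\lambda|^2+1}-1}$. Moreover, for every odd observable $A_1\in\mathcal A^o_X$ and every observable $A_2\in\mathcal A_Y$, $\omega^\Lambda_R(A_1A_2)=\omega^\Lambda_R(A_1)=0$.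
   Context: Let $\Lambda=[a,b]$ and $\mathcal F_\Lambda$ be the fermionic Fock space over $\ell^2(\Lambda)$ with CAR operators $c_x,c_x^*$ and vacuum $|\emptyset\rangle$. For $X\subset\Lambda$, $\mathcal A_X$ is the algebra generated by $c_x,c_x^*$, $x\in X$; $\mathcal A^e_X$ ($\mathcal A^o_X$) is the subspace spanned by even (odd) monomials in these operators. Tilings: a tile occupies consecutive sites and carries a 0/1 word (its particle content): void $0$; monomer $100$; dimer $011000$; left boundary dimer $11000$ (allowed only as the first tile of $\Lambda$); and, allowed only as the last tile of $\Lambda$: right dimer $011$, right 1-monomer $1$, right 2-monomer $10$, truncated 1-dimer $0110$, truncated 2-dimer $01100$. A root tiling $R$ of $\Lambda$ is a tiling of $\Lambda$ by consecutive tiles consisting of voids and monomers, optionally with a left boundary dimer as first tile and optionally with one of right dimer, right 1-monomer, right 2-monomer as last tile; $\mathcal R_\Lambda$ is the set of root tilings. A VMD tiling derived from $R$ is obtained by choosing a collection of disjoint pairs of consecutive tiles of $R$, each pair being either two monomers (replaced by a dimer) or a monomer followed by a right $j$-monomer, $j\in\{1,2\}$ (replaced by the truncated $j$-dimer); $\mathcal D_\Lambda(R)$ is the set of all such tilings (including $R$ itself). For a tile $D$ let $C_D^*$ be the product of $c_x^*$ over the sites $x$ of $D$ carrying a $1$, in increasing order of $x$ (and $C_D^*=1$ for a void), multiplied by $\lambda$ if $D$ is a dimer, left/right boundary dimer or truncated dimer. The fermionic VMD state is $\psi_\Lambda(R)=\sum_{(D_1,\dots,D_N)\in\mathcal D_\Lambda(R)}C_{D_1}^*\cdots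 C_{D_N}^*|\emptyset\rangle$ (tiles listed left to right), and $\omega^\Lambda_R(A)=\langle\psi_\Lambda(R),A\psi_\Lambda(R)\rangle/\|\psi_\Lambda(R)\|^2$. *)

(* Defs.v *)
From HB Require Import structures.
From mathcomp Require Import all_boot all_order all_algebra.
From mathcomp Require Import all_classical all_reals.
From mathcomp Require Import sequences exp.
From mathcomp Require Import complex.
Set Implicit Arguments. Unset Strict Implicit. Unset Printing Implicit Defensive.
Import Order.TTheory GRing.Theory Num.Theory.
Local Open Scope ring_scope.

(* sites of Lambda = [a, b] are identified with 'I_N, N = b - a + 1, via x |-> x - a *)

Inductive tile := Void | Mono | Dimer | LDimer | RDimer | R1Mono | R2Mono | T1Dimer | T2Dimer.

Definition word (t : tile) : seq bool :=
  match t with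
  | Void => [:: false]
  | Mono => [:: true; false; false]
  | Dimer => [:: false; true; true; false; false; false]
  | LDimer => [:: true; true; false; false; false]
  | RDimer => [:: false; true; true]
  | R1Mono => [:: true]
  | R2Mono => [:: true; false]
  | T1Dimer => [:: false; true; true; false]
  | T2Dimer => [:: false; true; true; false; false]
  end.

Definition has_lambda (t : tile) : bool :=
  match t with Dimer | LDimer | RDimer | T1Dimer | T2Dimer => true | _ => false end.

Definition tiles_len (T : seq tile) : nat := sumn [seq size (word t) | t <- T].

Definition is_VM (t : tile) : bool := match t with Void | Mono => true | _ => false end.
Definition is_right_root (t : tile) : bool :=
  match t with RDimer | R1Mono | R2Mono => true | _ => false end.

Definition root_tiling (N : nat) (T : seq tile) : Prop :=
  tiles_len T = N /\
  exists (l m r : seq tile),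
    T = l ++ m ++ r /\ (l = [::] \/ l = [:: LDimer]) /\ all is_VM m /\
    (r = [::] \/ exists t, r = [:: t] /\ is_right_root t).

Fixpoint derive (T : seq tile) : seq (seq tile) :=
  match T with
  | [::] => [:: [::]]
  | d :: T' =>
    let rest := [seq d :: s | s <- derive T'] in
    match d, T' with
    | Mono, Mono :: T'' => rest ++ [seq Dimer :: s | s <- derive T'']
    | Mono, R1Mono :: T'' => rest ++ [seq T1Dimer :: s | s <- derive T'']
    | Mono, R2Mono :: T'' => rest ++ [seq T2Dimer :: s | s <- derive T'']
    | _, _ => rest
    end
  end.

Section Fock.
Variable R : realType.
Local Notation C := R[i].
Variable N : nat.

Definition fock := {set 'I_N} -> C.
Definition op := fock -> fock.

Definition jw (x : 'I_N) (S : {set 'I_N}) : C :=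
  (-1) ^+ #|finset.finset [pred y | (y \in S) && (y < x)%N]|.

(* c_x^* |S> = jw x S |S u {x}> if x \notin S, 0 otherwise *)
Definition cdag (x : 'I_N) : op := fun psi S =>
  if x \in S then jw x (S :\ x) * psi (S :\ x) else 0.
(* c_x, the adjoint of c_x^* *)
Definition cann (x : 'I_N) : op := fun psi S =>
  if x \in S then 0 else jw x S * psi (x |: S).

Definition vac : fock := fun S => if S == finset.set0 then 1 else 0.

Definition opmul (A B : op) : op := fun psi => A (B psi).
Definition opid : op := fun psi => psi.

Definition mono (w : seq (bool * 'I_N)) : op :=
  foldr (fun l M => opmul (if l.1 then cdag l.2 else cann l.2) M) opid w.

Definition lincomb (ws : seq (C * seq (bool * 'I_N))) : op :=
  fun psi S => \sum_(w <- ws) w.1 * mono w.2 psi S.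

Definition in_CAR (X : {set 'I_N}) (A : op) : Prop :=
  exists ws : seq (C * seq (bool * 'I_N)),
    all (fun w => all (fun l => l.2 \in X) w.2) ws /\ A = lincomb ws.
Definition in_CAR_par (p : bool) (X : {set 'I_N}) (A : op) : Prop :=
  exists ws : seq (C * seq (bool * 'I_N)),
    all (fun w => all (fun l => l.2 \in X) w.2 && (odd (size w.2) == p)) ws
    /\ A = lincomb ws.
Definition in_CAR_even (X : {set 'I_N}) (A : op) : Prop := in_CAR_par false X A.
Definition in_CAR_odd (X : {set 'I_N}) (A : op) : Prop := in_CAR_par true X A.

Definition inner (psi phi : fock) : C := \sum_S conjc (psi S) * phi S.
Definition vnorm (psi : fock) : R := Num.sqrt (\sum_S (Normc.normc (psi S)) ^+ 2).
Definition opnorm (A : op) : R :=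
  sup [set r : R | exists psi : fock, vnorm psi <= 1 /\ r = vnorm (A psi)].

Definition tile_op (lam : C) (p : nat) (t : tile) : op :=
  (* sites p + k carrying a 1, increasing; (for tiles of a tiling of Lambda
     these sites are always < N, so insub never fails) *)
  let w := pmap (fun k => omap (fun x : 'I_N => (true, x)) (insub (p + k)))
             [seq k <- iota 0 (size (word t)) | nth false (word t) k] in
  fun psi S => (if has_lambda t then lam else 1) * mono w psi S.

Fixpoint tiling_op (lam : C) (p : nat) (T : seq tile) : op :=
  match T with
  | [::] => opid
  | t :: T' => opmul (tile_op lam p t) (tiling_op lam (p + size (word t)) T')
  end.

Definition vmd_state (lam : C) (T : seq tile) : fock :=
  fun S => \sum_(D <- derive T) tiling_op lam 0 D vac S.

Definition omega (lam : C) (T : seq tile) (A : op) : C :=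
  inner (vmd_state lam T) (A (vmd_state lam T)) / inner (vmd_state lam T) (vmd_state lam T).

End Fock.

Definition site_interval (N i j : nat) : {set 'I_N} := finset.finset [pred x : 'I_N | (i <= x <= j)%N].

Definition sdist (N : nat) (X Y : {set 'I_N}) : nat :=
  \big[minn/N]_(x in X) \big[minn/N]_(y in Y) `|(x : int) - (y : int)|%N.

Definition cconst {R : realType} (lam : R[i]) : R :=
  let s := Num.sqrt (4 * (Normc.normc lam) ^+ 2 + 1) in
  3^-1 * ln ((s + 1) / (s - 1)).

(* Main.v *)
(** The occupation amplitudes of the VMD state form a matrix product.  A tile of
    the root tiling is read together with a bit telling whether the bond to its
    left is covered by a dimer, and each occupation word of a tile fixes both its
    left and its right bit.  Cutting the root tiling at the outer ends of the gap
    between [X] and [Y], the state is a sum over two bits [p], [q] of products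
    [u_p * phi_pq * v_q], where the middle factors [phi_pq] have disjoint supports.
    Hence for even observables
      [<psi, A1 A2 psi> = sum_pq F_p W_pq G_q]
    and the covariance is [det W] times two 2x2 minors.  The matrix [W] is the
    product of the tile matrices: a monomer contributes [[1, 1], [x, 0]] with
    [x = |lam|^2], every other tile a singular matrix.  So either the covariance
    vanishes or [W] is a power of the monomer matrix, whose eigenvalues
    [(1 +- s)/2] have ratio of modulus [(s - 1)/(s + 1)], that is [e^(-3c)].
    Odd expectations vanish because every [u_p] and every [v_q] has a definite
    particle parity. *)

Require Import Defs.
From HB Require Import structures.
From mathcomp Require Import all_boot all_order all_algebra.
From mathcomp Require Import all_classical all_reals.
From mathcomp Require Import sequences exp.
From mathcomp Require Import complex.
From mathcomp Require Import ring lra zify.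
From mathcomp Require Import fintype finset.
Import Order.TTheory GRing.Theory Num.Theory.
Local Open Scope ring_scope.
Set Implicit Arguments. Unset Strict Implicit. Unset Printing Implicit Defensive.

Arguments mono : simpl never.
Arguments Normc.normc : simpl never.

(** * Sums over the subsets of a disjoint union *)

Section SplitSum.
Variables (V : comPzSemiRingType) (F : finType).

(** A subset of [A :|: B] is the same as a pair of its traces on [A] and [B]. This is the tensor
    factorisation of Fock space at the level of configurations. *)
Lemma sum_subsets_setU (A B : {set F}) (f g : {set F} -> V) : [disjoint A & B] ->
  \sum_(S : {set F} | S \subset A :|: B) f (S :&: A) * g (S :&: B) =
  (\sum_(S : {set F} | S \subset A) f S) * (\sum_(S : {set F} | S \subset B) g S).
Proof.
move=> dAB; rewrite big_distrlr /= pair_big /=.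
rewrite (reindex_onto (fun P : {set F} * {set F} => P.1 :|: P.2)
  (fun S => (S :&: A, S :&: B))) /=; last first.
  by move=> S sS; rewrite -setIUr; apply/setIidPl.
apply: eq_big => [[P Q]|[P Q]] /=.
  apply/andP/andP => [[sPQ /eqP[]]|[sP sQ]].
    by move=> <- <-; rewrite !subsetIr.
  split; first exact: setUSS.
  have PB : P :&: B = set0 by apply/eqP; rewrite setI_eq0; apply: disjointWl dAB.
  have QA : Q :&: A = set0.
    by apply/eqP; rewrite setI_eq0; apply: disjointWl sQ _; rewrite disjoint_sym.
  by rewrite !setIUl PB QA setU0 set0U (setIidPl sP) (setIidPl sQ).
by move=> /andP[_ /eqP[-> ->]].
Qed.
End SplitSum.

(** * Fermionic operators: linearity, particle parity and signs *)

Section Operators.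
Variables (R : realType) (N : nat).
Local Notation C := R[i].
Local Notation conf := {set 'I_N}.
Local Notation fk := (fock R N).
Implicit Types (S Z X : conf) (f g h u v psi phi : fk) (w : seq (bool * 'I_N)).

Lemma mono_cons (l : bool * 'I_N) w psi :
  @mono R N (l :: w) psi = (if l.1 then cdag l.2 else cann l.2) (mono w psi).
Proof. by []. Qed.

Lemma mono_sum (I : Type) (r : seq I) (c : I -> C) (F : I -> fk) w :
  mono w (fun S => \sum_(i <- r) c i * F i S) =
  (fun S => \sum_(i <- r) c i * mono w (F i) S).
Proof.
elim: w => [//|[b x] w IH]; rewrite mono_cons IH; apply/funext => S.
case: b; rewrite /= /cdag /cann; case: ifP => xS.
- by rewrite big_distrr; apply: eq_bigr => i _; rewrite mono_cons /= /cdag xS; ring.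
- by rewrite big1 // => i _; rewrite mono_cons /= /cdag xS mulr0.
- by rewrite big1 // => i _; rewrite mono_cons /= /cann xS mulr0.
- by rewrite big_distrr; apply: eq_bigr => i _; rewrite mono_cons /= /cann xS; ring.
Qed.

Lemma lincomb_sumZ (I : Type) (r : seq I) (c : I -> C) (F : I -> fk) ws :
  lincomb ws (fun S => \sum_(i <- r) c i * F i S) =
  (fun S => \sum_(i <- r) c i * lincomb ws (F i) S).
Proof.
apply/funext => S; rewrite /lincomb.
under eq_bigr do rewrite mono_sum big_distrr /=.
rewrite exchange_big; apply: eq_bigr => i _; rewrite big_distrr.
by apply: eq_bigr => l _ /=; ring.
Qed.

Lemma lincomb_sum (I : Type) (r : seq I) (F : I -> fk) ws :
  lincomb ws (fun S => \sum_(i <- r) F i S) =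
  (fun S => \sum_(i <- r) lincomb ws (F i) S).
Proof.
have E (G : I -> fk) : (fun S => \sum_(i <- r) G i S) =
  (fun S => \sum_(i <- r) 1 * G i S).
  by apply/funext => S; apply: eq_bigr => i _; rewrite mul1r.
by rewrite E lincomb_sumZ -E.
Qed.

Lemma lincombZ (c : C) psi ws :
  lincomb ws (fun S => c * psi S) = (fun S => c * lincomb ws psi S).
Proof.
have := @lincomb_sumZ unit [:: tt] (fun=> c) (fun=> psi) ws.
by under [in LHS]eq_fun do rewrite big_seq1; under [in RHS]eq_fun do rewrite big_seq1.
Qed.

(** Eigenvectors of the fermion parity operator; the zero vector has both parities. *)
Definition supp_parity (e : bool) psi := forall S, psi S != 0 -> odd #|S| = e.

Lemma mono_parity (e : bool) psi w : supp_parity e psi ->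
  supp_parity (odd (size w) (+) e) (mono w psi).
Proof.
move=> pe; elim: w => [//|[b x] w IH] S.
rewrite mono_cons /=; case: b; rewrite /= /cdag /cann; case: ifP => xS;
  rewrite ?eqxx // mulf_eq0 negb_or => /andP[_ /IH].
- by move=> H; rewrite (cardsD1 x S) xS oddD H addNb.
- by rewrite cardsU1 xS oddD addNb => <-; rewrite negbK.
Qed.

Lemma lincomb_parity (p e : bool) psi ws :
  all (fun l : C * seq (bool * 'I_N) => odd (size l.2) == p) ws ->
  supp_parity e psi -> supp_parity (p (+) e) (lincomb ws psi).
Proof.
move=> /allP ha pe S; apply: contraNeq => ne.
rewrite /lincomb big_seq big1 // => l /ha /eqP lp.
have [->|nz] := eqVneq (mono l.2 psi S) 0; first by rewrite mulr0.
by rewrite (mono_parity pe nz) lp eqxx in ne.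
Qed.


Lemma supp_parity_mul0 (e e' : bool) (Z : {pred conf}) psi phi : e != e' ->
  supp_parity e psi -> supp_parity e' phi ->
  \sum_(S | Z S) conjc (psi S) * phi S = 0.
Proof.
move=> ne pe pe'; apply: big1 => S _.
have [->|/pe h] := eqVneq (psi S) 0; first by rewrite conjc0 mul0r.
have [->|/pe' h'] := eqVneq (phi S) 0; first by rewrite mulr0.
by rewrite -h -h' eqxx in ne.
Qed.

(** The fermion parity operator raised to the power [b]: the sign that an operator leaves on a block
    to its left. *)
Definition twist (b : bool) psi : fk := fun S => (-1) ^+ (b && odd #|S|) * psi S.

Lemma twist0 psi : twist false psi = psi.
Proof. by apply/funext => S; rewrite /twist mul1r. Qed.

Lemma twistD (b c : bool) psi : twist b (twist c psi) = twist (b (+) c) psi.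
Proof.
apply/funext => S; rewrite /twist mulrA -signr_addb; congr (_ ^+ _ * _).
by case: b; case: c; case: odd.
Qed.

Lemma twist_parity (b e : bool) psi : supp_parity e psi -> supp_parity e (twist b psi).
Proof. by move=> pe S; rewrite /twist mulf_eq0 negb_or => /andP[_ /pe]. Qed.

Lemma jw_odd (x : 'I_N) S : jw R x S = (-1) ^+ odd #|[set y in S | (y < x)%N]|.
Proof. by rewrite signr_odd. Qed.

Definition seg (a b : nat) : conf := [set x : 'I_N | (a <= x < b)%N].


Lemma setD1I_out (x : 'I_N) S Z : x \notin Z -> (S :\ x) :&: Z = S :&: Z.
Proof.
by move=> xZ; apply/setP => y; rewrite !inE; case: eqVneq xZ => [->|//] /negbTE ->; rewrite !andbF.
Qed.

Lemma setU1I_out (x : 'I_N) S Z : x \notin Z -> (x |: S) :&: Z = S :&: Z.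
Proof.
by move=> xZ; apply/setP => y; rewrite !inE; case: eqVneq xZ => [->|//] /negbTE ->; rewrite !andbF.
Qed.

Lemma setU1I_in (x : 'I_N) S Z : x \in Z -> (x |: S) :&: Z = x |: (S :&: Z).
Proof. by move=> xZ; apply/setP => y; rewrite !inE; case: eqVneq xZ => [->|//] ->. Qed.

(** * Product vectors over three consecutive blocks of sites *)

Section Tensor.
Variables (a b : nat).
Hypotheses (ab : (a <= b)%N) (bN : (b <= N)%N).
Local Notation L := (seg 0 a).
Local Notation M := (seg a b).
Local Notation G := (seg b N).

(** Each factor is read only at configurations inside its own block, so its values elsewhere do not
    matter. *)
Definition tens3 u f v : fk := fun S => u (S :&: L) * f (S :&: M) * v (S :&: G).

Lemma jw_left (x : 'I_N) S : (x < a)%N -> jw R x S = jw R x (S :&: L).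
Proof.
move=> xa; rewrite !jw_odd; congr (_ ^+ odd #|pred_of_set _|).
by apply/setP => y; rewrite !inE; case: (y \in S) => //=; lia.
Qed.

(** The blocks [L] and [M] lie entirely to the left of [x], so their particle parities split off
    from the string. *)
Lemma jw_right (x : 'I_N) S : (b <= x)%N ->
  jw R x S = (-1) ^+ odd #|S :&: L| * (-1) ^+ odd #|S :&: M| * jw R x (S :&: G).
Proof.
move=> bx; rewrite !jw_odd -!signr_addb; congr (_ ^+ nat_of_bool _).
rewrite -!oddD; congr odd.
pose T1 := [set y in S | y < x]%N.
rewrite -/T1 -(cardsID L T1) -(cardsID M (T1 :\: L)) addnA.
congr (_ + _ + _)%N; apply: eq_card => y; rewrite !inE;
  case: (y \in S) => //=; have := ltn_ord y; lia.
Qed.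

(** The Jordan-Wigner string of a site in the left block stays inside that block, so no sign reaches
    the other factors. *)
Lemma cdag_tens3l (x : 'I_N) u f v : (x < a)%N ->
  cdag x (tens3 u f v) = tens3 (cdag x u) f v.
Proof.
move=> xa; apply/funext => S; rewrite /tens3 /cdag !inE xa andbT.
case: ifP => xS; last by rewrite !mul0r.
rewrite (jw_left _ xa) -[(S :&: L) :\ x]setIDAC.
by rewrite !(@setD1I_out _ _ M, @setD1I_out _ _ G) ?inE ?mulrA //; lia.
Qed.

Lemma cann_tens3l (x : 'I_N) u f v : (x < a)%N ->
  cann x (tens3 u f v) = tens3 (cann x u) f v.
Proof.
move=> xa; apply/funext => S; rewrite /tens3 /cann !inE xa andbT.
case: ifP => xS; first by rewrite !mul0r.
rewrite (jw_left _ xa) (@setU1I_in _ _ L) ?inE //.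
by rewrite !(@setU1I_out _ _ M, @setU1I_out _ _ G) ?inE ?mulrA //; lia.
Qed.

Lemma cdag_tens3r (x : 'I_N) u f v : (b <= x)%N ->
  cdag x (tens3 u f v) = tens3 (twist true u) (twist true f) (cdag x v).
Proof.
move=> bx; apply/funext => S; rewrite /tens3 /cdag /twist /= !inE bx ltn_ord andbT.
case: ifP => xS; last by rewrite !mulr0.
rewrite (jw_right _ bx) -[(S :&: G) :\ x]setIDAC.
by rewrite !(@setD1I_out _ _ M, @setD1I_out _ _ L) ?inE /=; [ring|lia|lia].
Qed.

Lemma cann_tens3r (x : 'I_N) u f v : (b <= x)%N ->
  cann x (tens3 u f v) = tens3 (twist true u) (twist true f) (cann x v).
Proof.
move=> bx; apply/funext => S; rewrite /tens3 /cann /twist /= !inE bx ltn_ord andbT.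
case: ifP => xS; first by rewrite !mulr0.
rewrite (jw_right _ bx) (@setU1I_in _ _ G) ?inE ?bx ?ltn_ord //.
by rewrite !(@setU1I_out _ _ M, @setU1I_out _ _ L) ?inE /=; [ring|lia|lia].
Qed.

Lemma mono_tens3l w u f v : all (fun l : bool * 'I_N => (l.2 < a)%N) w ->
  mono w (tens3 u f v) = tens3 (mono w u) f v.
Proof.
elim: w => [//|[c x] w IH] /= /andP[xa /IH]; rewrite !mono_cons => -> /=.
by case: c; rewrite ?cdag_tens3l ?cann_tens3l.
Qed.

(** Every letter contributes one twist of the left and middle factors, and twists cancel in
    pairs. *)
Lemma mono_tens3r w u f v : all (fun l : bool * 'I_N => (b <= l.2)%N) w ->
  mono w (tens3 u f v) =
  tens3 (twist (odd (size w)) u) (twist (odd (size w)) f) (mono w v).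
Proof.
elim: w => [|[c x] w IH] /=; first by rewrite !twist0.
move=> /andP[xa /IH]; rewrite !mono_cons => -> /=.
by case: c; rewrite ?cdag_tens3r ?cann_tens3r // !twistD addTb.
Qed.

Lemma lincomb_tens3l ws u f v :
  all (fun l : C * seq (bool * 'I_N) => all (fun l : bool * 'I_N => (l.2 < a)%N) l.2) ws ->
  lincomb ws (tens3 u f v) = tens3 (lincomb ws u) f v.
Proof.
move=> /allP h; apply/funext => S; rewrite /tens3 /lincomb !big_distrl /=.
by apply: eq_big_seq => l /h h'; rewrite mono_tens3l // /tens3 !mulrA.
Qed.

(** A common parity [p] of all words makes their twists agree, so the sum over words acts on [v]
    alone. *)
Lemma lincomb_tens3r p ws u f v :
  all (fun l : C * seq (bool * 'I_N) =>
    all (fun l : bool * 'I_N => (b <= l.2)%N) l.2 && (odd (size l.2) == p)) ws ->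
  lincomb ws (tens3 u f v) = tens3 (twist p u) (twist p f) (lincomb ws v).
Proof.
move=> /allP h; apply/funext => S; rewrite /tens3 /lincomb !big_distrr /=.
apply: eq_big_seq => l /h /andP[h' /eqP <-].
by rewrite mono_tens3r // /tens3; ring.
Qed.

Definition inn Z f g : C := \sum_(S : conf | S \subset Z) conjc (f S) * g S.

Lemma inner_tens3 u f v u' f' v' :
  inner (tens3 u f v) (tens3 u' f' v') = inn L u u' * inn M f f' * inn G v v'.
Proof.
have dLM : [disjoint L & M].
  by rewrite -setI_eq0; apply/eqP/setP => x; rewrite !inE; lia.
have dLMG : [disjoint L :|: M & G].
  by rewrite -setI_eq0; apply/eqP/setP => x; rewrite !inE; lia.
have LMG : L :|: M :|: G = setT.
  by apply/setP => x; rewrite !inE; have := ltn_ord x; lia.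
rewrite /inn -sum_subsets_setU // -sum_subsets_setU // LMG /inner.
apply: eq_big => [S|S _]; first by rewrite subsetT.
rewrite /tens3 !rmorphM.
have -> : S :&: (L :|: M) :&: L = S :&: L.
  by rewrite -setIA; congr (_ :&: _); apply/setIidPr; apply: subsetUl.
have -> : S :&: (L :|: M) :&: M = S :&: M.
  by rewrite -setIA; congr (_ :&: _); apply/setIidPr; apply: subsetUr.
by ring.
Qed.

Lemma inn_vac Z : inn Z (@vac R N) (@vac R N) = 1.
Proof.
rewrite /inn (bigD1 set0) ?sub0set //= big1 ?addr0.
  by rewrite /vac eqxx conjc1 mulr1.
by move=> S /andP[_ /negbTE S0]; rewrite /vac S0 mulr0.
Qed.

End Tensor.
End Operators.

(** * Norms *)

Section Norms.
Variables (R : realType) (N : nat).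
Local Notation C := R[i].
Local Notation conf := {set 'I_N}.
Local Notation fk := (fock R N).
Local Notation normc := (@Normc.normc R).
Implicit Types (S : conf) (f g psi : fk) (ws : seq (C * seq (bool * 'I_N))).

Lemma normc_ge0 (z : C) : 0 <= normc z.
Proof. by case: z => x y; apply: sqrtr_ge0. Qed.

Lemma normcD (x y : C) : normc (x + y) <= normc x + normc y.
Proof. exact: (@le_normcD R). Qed.

Lemma normcB (x y : C) : normc (x - y) <= normc x + normc y.
Proof. by apply: le_trans (normcD _ _) _; rewrite lerD2l (@normcN R). Qed.

Lemma normc_sum (I : Type) (r : seq I) (P : pred I) (F : I -> C) :
  normc (\sum_(i <- r | P i) F i) <= \sum_(i <- r | P i) normc (F i).
Proof.
elim/big_rec2: _ => [|i x y _ h]; first by rewrite Normc.normc0.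
by apply: le_trans (normcD _ _) _; rewrite lerD2l.
Qed.

Lemma normc_realE (x : R) : normc x%:C%C = `|x|.
Proof. by rewrite /Normc.normc /= expr0n addr0 sqrtr_sqr. Qed.

Lemma normc_real (x : R) : 0 <= x -> normc x%:C%C = x.
Proof. by rewrite normc_realE => /ger0_norm. Qed.

Lemma conjc_mul_normc (z : C) : conjc z * z = ((normc z) ^+ 2)%:C%C.
Proof.
case: z => x y; rewrite /Normc.normc sqr_sqrtr ?addr_ge0 ?sqr_ge0 //.
by apply/eqP; rewrite eq_complex /=; apply/andP; split; apply/eqP; ring.
Qed.

Lemma normc_conj (z : C) : normc (conjc z) = normc z.
Proof. by case: z => x y; rewrite /Normc.normc /= sqrrN. Qed.

Lemma normc_sign (n : nat) : normc ((-1) ^+ n) = 1.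
Proof.
elim: n => [|n IH]; first by rewrite Normc.normc1.
by rewrite exprS Normc.normcM IH mulr1 (@normcN R) Normc.normc1.
Qed.

Lemma vnorm_ge0 f : 0 <= vnorm f.
Proof. exact: sqrtr_ge0. Qed.

Lemma vnorm_sqr f : vnorm f ^+ 2 = \sum_S normc (f S) ^+ 2.
Proof. by rewrite sqr_sqrtr // sumr_ge0 // => S _; rewrite exprn_ge0 ?normc_ge0. Qed.

Lemma inner_self f : inner f f = (vnorm f ^+ 2)%:C%C.
Proof.
by rewrite vnorm_sqr rmorph_sum; apply: eq_bigr => S _; rewrite conjc_mul_normc.
Qed.

Lemma vnormZ (c : R) f : 0 <= c -> vnorm (fun S => c%:C%C * f S) = c * vnorm f.
Proof.
move=> c0; apply/eqP; rewrite -(@eqrXn2 _ 2) ?mulr_ge0 ?vnorm_ge0 //; apply/eqP.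
rewrite exprMn !vnorm_sqr big_distrr; apply: eq_bigr => S _.
by rewrite Normc.normcM normc_real // exprMn.
Qed.

Lemma normc_le_vnorm f S : normc (f S) <= vnorm f.
Proof.
rewrite -(@ler_pXn2r _ 2) ?nnegrE ?normc_ge0 ?vnorm_ge0 // vnorm_sqr.
rewrite (bigD1 S) //= lerDl sumr_ge0 // => S' _.
by rewrite exprn_ge0 ?normc_ge0.
Qed.

Lemma vnorm_eq0 f S : vnorm f = 0 -> f S = 0.
Proof.
move=> f0; apply: (@Normc.eq0_normc R); apply/eqP.
by rewrite eq_le normc_ge0 -{1}f0 normc_le_vnorm.
Qed.

Lemma inner_le f g : normc (inner f g) <= vnorm f * vnorm g.
Proof.
have [f0|f0] := eqVneq (vnorm f) 0.
  rewrite /inner big1 ?Normc.normc0 ?f0 ?mul0r // => S _.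
  by rewrite (vnorm_eq0 S f0) conjc0 mul0r.
have [g0|g0] := eqVneq (vnorm g) 0.
  rewrite /inner big1 ?Normc.normc0 ?g0 ?mulr0 // => S _.
  by rewrite (vnorm_eq0 S g0) mulr0.
have pf : 0 < vnorm f by rewrite lt_neqAle eq_sym f0 vnorm_ge0.
have pg : 0 < vnorm g by rewrite lt_neqAle eq_sym g0 vnorm_ge0.
apply: le_trans (normc_sum _ _ _) _.
set p := vnorm f; set q := vnorm g.
(* AM-GM with weights q/p and p/q *)
have h S : normc (conjc (f S) * g S) <=
    (q / p) / 2 * normc (f S) ^+ 2 + (p / q) / 2 * normc (g S) ^+ 2.
  rewrite Normc.normcM normc_conj; set a := normc _; set b := normc _.
  rewrite -subr_ge0.
  have -> : q / p / 2 * a ^+ 2 + p / q / 2 * b ^+ 2 - a * b =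
     (q * a - p * b) ^+ 2 / (2 * p * q).
    by field; rewrite f0 g0.
  by rewrite divr_ge0 ?sqr_ge0 // !mulr_ge0 // ltW.
apply: le_trans (ler_sum _ (fun S _ => h S)) _.
rewrite big_split /= -!big_distrr /= -!vnorm_sqr -/p -/q.
by rewrite le_eqVlt; apply/orP; left; apply/eqP; field; rewrite f0 g0.
Qed.

(** A creation or annihilation operator only moves amplitudes between configurations, up to sign, or
    kills them. *)
Lemma mono_bound (K : R) w psi : (forall S, normc (psi S) <= K) ->
  forall S, normc (mono w psi S) <= K.
Proof.
move=> h; have K0 : 0 <= K by apply: le_trans (h set0); apply: normc_ge0.
elim: w => [//|[b x] w IH] S; rewrite mono_cons; case: b; rewrite /= /cdag /cann;
  by case: ifP => _; rewrite ?Normc.normc0 // Normc.normcM normc_sign mul1r.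
Qed.

(** [opnorm] is a [sup], which is meaningful only for a bounded set. The coefficients of [ws] give a
    crude bound on each amplitude. *)
Lemma opnorm_has_ub ws :
  has_ubound [set r : R | exists psi : fk, vnorm psi <= 1 /\ r = vnorm (lincomb ws psi)]%classic.
Proof.
pose K := \sum_(l <- ws) normc l.1.
have K0 : 0 <= K by rewrite sumr_ge0 // => l _; apply: normc_ge0.
exists (Num.sqrt (\sum_(S : conf) K ^+ 2)) => _ [psi [p1 ->]].
rewrite ler_wsqrtr // ler_sum // => S _.
rewrite ler_pXn2r ?nnegrE ?normc_ge0 //.
apply: le_trans (normc_sum _ _ _) _; apply: ler_sum => l _.
rewrite Normc.normcM ler_piMr ?normc_ge0 // mono_bound // => S'.
exact: le_trans (normc_le_vnorm _ _) p1.
Qed.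

Lemma opnorm_ge ws psi : vnorm (lincomb ws psi) <= opnorm (lincomb ws) * vnorm psi.
Proof.
have [p0|p0] := eqVneq (vnorm psi) 0.
  (* A vector of norm zero equals [0 * psi], so linearity settles the case in which rescaling is
     impossible. *)
  have -> : vnorm (lincomb ws psi) = 0.
    have -> : psi = (fun S => (0 : R)%:C%C * psi S).
      by apply/funext => S; rewrite (vnorm_eq0 S p0) mulr0.
    by rewrite lincombZ vnormZ // mul0r.
  by rewrite p0 mulr0.
have pp : 0 < vnorm psi by rewrite lt_neqAle eq_sym p0 vnorm_ge0.
rewrite -ler_pdivrMr // mulrC -vnormZ ?invr_ge0 ?vnorm_ge0 // -lincombZ.
apply: ub_le_sup; first exact: opnorm_has_ub.
by eexists; split; last reflexivity; rewrite vnormZ ?invr_ge0 ?vnorm_ge0 // mulVf.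
Qed.

Lemma opnorm_ge0 ws : 0 <= opnorm (lincomb ws : op R N).
Proof.
apply: ub_le_sup; first exact: opnorm_has_ub.
exists (fun=> 0); split.
  by rewrite /vnorm big1 ?sqrtr0 // => S _; rewrite Normc.normc0 expr0n.
have -> : (fun=> 0) = (fun S => (0 : R)%:C%C * (fun=> 0) S) :> fk.
  by apply/funext => S; rewrite mulr0.
by rewrite lincombZ vnormZ // mul0r.
Qed.

Lemma inner_op_le ws f :
  normc (inner f (lincomb ws f)) <= opnorm (lincomb ws) * vnorm f ^+ 2.
Proof.
apply: le_trans (inner_le _ _) _.
by rewrite expr2 mulrA mulrC ler_wpM2r ?vnorm_ge0 // opnorm_ge.
Qed.

End Norms.

(** * Tilings as matrix products *)

(* [p] and [q] tell whether the bond to the left, resp. right, of the tile is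
   covered by a dimer; where [tcoef] below vanishes the word is a junk value. *)
Definition tword (t : tile) (p q : bool) : seq bool :=
  match p, q with
  | false, false => word t
  | false, true => if t is Mono then [:: false; true; true] else nseq (size (word t)) false
  | _, _ => nseq (size (word t)) false
  end.

Lemma size_tword t p q : size (tword t p q) = size (word t).
Proof. by case: t p q => [] [] []. Qed.

Lemma tiles_len_cons t T : tiles_len (t :: T) = (size (word t) + tiles_len T)%N.
Proof. by []. Qed.

Lemma tiles_len_cat T1 T2 : tiles_len (T1 ++ T2) = (tiles_len T1 + tiles_len T2)%N.
Proof. by rewrite /tiles_len map_cat sumn_cat. Qed.

Lemma derive_len T : all (fun D => tiles_len D == tiles_len T) (derive T).
Proof.
(* Induction on the size, because [derive] may consume two tiles at once. *)
have [n] := ubnP (size T); elim: n T => // n IH [//|t T] /= sT.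
have hcons t' : all (fun D => tiles_len D == tiles_len (t' :: T)) [seq t' :: s | s <- derive T].
  by rewrite all_map; apply: sub_all (IH T _) => // D /eqP; rewrite /= !tiles_len_cons => ->.
case: t => //; case: T sT hcons => [//|t' T] sT hcons //.
have hT : all (fun D => tiles_len D == tiles_len T) (derive T) by apply: IH; move: sT => /=; lia.
case: t' sT hcons => // sT hcons; rewrite all_cat hcons /= all_map;
  apply: sub_all hT => D /eqP /= h; by rewrite !tiles_len_cons h.
Qed.

Section Amplitudes.
Variables (R : realType) (N : nat) (lam : R[i]).
Local Notation C := R[i].
Local Notation conf := {set 'I_N}.
Local Notation fk := (fock R N).
Local Notation seg := (@seg N).
Local Notation normc := (@Normc.normc R).
Implicit Types (S : conf) (T D : seq tile) (t : tile) (p q r : bool) (k n : nat).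

(** Occupation at a natural number, false beyond the lattice, so that words can be read off without
    bound proofs. *)
Definition occ S k : bool := [exists x : 'I_N, (x \in S) && (x == k :> nat)].

Lemma occ_ord S (x : 'I_N) : occ S x = (x \in S).
Proof.
apply/existsP/idP => [[y /andP[yS /eqP /val_inj <-]]//|xS].
by exists x; rewrite xS eqxx.
Qed.

Lemma occ_setI_seg S a b k : (a <= k < b)%N -> occ (S :&: seg a b) k = occ S k.
Proof.
move=> h; apply: eq_existsb => x; rewrite !inE.
by case: (eqVneq (x : nat) k) => [->|]; rewrite ?andbF // h andbT.
Qed.

Definition wrd S k n : seq bool := [seq occ S i | i <- iota k n].

Lemma size_wrd S k n : size (wrd S k n) = n.
Proof. by rewrite size_map size_iota. Qed.

Lemma wrdD S k n m : wrd S k (n + m) = wrd S k n ++ wrd S (k + n) m.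
Proof. by rewrite /wrd iotaD map_cat. Qed.

Lemma nth_wrd S k n i : (i < n)%N -> nth false (wrd S k n) i = occ S (k + i).
Proof. by move=> h; rewrite (nth_map 0%N) ?size_iota // nth_iota. Qed.

Lemma eq_wrd S S' k n : (forall i, (k <= i < k + n)%N -> occ S i = occ S' i) ->
  wrd S k n = wrd S' k n.
Proof. by move=> h; apply/eq_in_map => i; rewrite mem_iota => /h. Qed.

Lemma wrd_setI S k n a b : (a <= k)%N -> (k + n <= b)%N ->
  wrd (S :&: seg a b) k n = wrd S k n.
Proof. by move=> ak kb; apply: eq_wrd => i h; apply: occ_setI_seg; lia. Qed.

Lemma count_wrd S k n : (k + n <= N)%N -> count id (wrd S k n) = #|S :&: seg k (k + n)|.
Proof.
elim: n => [|n IH] kn.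
  rewrite addn0 (_ : _ :&: _ = set0) ?cards0 //.
  by apply/setP => x; rewrite !inE; lia.
rewrite -[in wrd _ _ _]addn1 wrdD count_cat IH /=; last by lia.
have kN : (k + n < N)%N by lia.
rewrite addn0 (occ_ord S (Ordinal kN)) [LHS]addnC [RHS](cardsD1 (Ordinal kN)) !inE /=.
congr (_ + _)%N; first by case: (_ \in _); lia.
apply: eq_card => x; rewrite !inE -val_eqE /=; case: (x \in S); lia.
Qed.

(** The factor [lam] of a dimer formed from two root tiles is charged to its second tile, the one
    whose left bit is set. The entry at [true, true] vanishes because replaced pairs are
    disjoint. *)
Definition tcoef t p q : C :=
  match p, q with
  | false, false => if has_lambda t then lam else 1
  | false, true => if t is Mono then 1 else 0
  | true, false => match t with Mono | R1Mono | R2Mono => lam | _ => 0 end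
  | true, true => 0
  end.

Definition tamp t (w : seq bool) p q : C := tcoef t p q * (w == tword t p q)%:R.

Fixpoint amp T k S p q : C :=
  if T is t :: T' then
    tamp t (wrd S k (size (word t))) p false * amp T' (k + size (word t)) S false q +
    tamp t (wrd S k (size (word t))) p true * amp T' (k + size (word t)) S true q
  else (p == q)%:R.

Lemma amp_cat T1 T2 k S p q : amp (T1 ++ T2) k S p q =
  amp T1 k S p false * amp T2 (k + tiles_len T1) S false q +
  amp T1 k S p true * amp T2 (k + tiles_len T1) S true q.
Proof.
elim: T1 k p => [|t T1 IH] k p /=.
  by rewrite addn0; case: p; rewrite ?(mul0r, mul1r, add0r, addr0).
by rewrite !IH tiles_len_cons addnA; ring.
Qed.

Lemma amp_setI T k S p q a b : (a <= k)%N -> (k + tiles_len T <= b)%N ->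
  amp T k (S :&: seg a b) p q = amp T k S p q.
Proof.
elim: T k p => [//|t T IH] k p ak; rewrite tiles_len_cons => kb /=.
by rewrite !IH ?wrd_setI //; lia.
Qed.

(** The nonzero entries of a tile carry pairwise distinct words, for instance [100], [011] and [000]
    for a monomer, so the word fixes both bits. *)
Lemma tamp_disjoint t w p q p' q' : (p, q) != (p', q') ->
  tamp t w p q * tamp t w p' q' = 0.
Proof.
move=> ne; rewrite /tamp mulrACA -natrM mulnb.
case: (eqVneq w (tword t p q)) => [->|]; last by rewrite mulr0.
by case: t p q p' q' ne => [] [] [] [] [] //= _; rewrite ?(mulr0, mul0r).
Qed.

Lemma amp_disjoint_right T k S p q q' : q != q' ->
  amp T k S p q * amp T k S p q' = 0.
Proof.
move=> ne; elim: T k p => [|t T IH] k p /=.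
  by case: p q q' ne => [] [] []; rewrite ?(mulr0, mul0r).
set w := wrd _ _ _; set k' := (k + _)%N.
have d : tamp t w p false * tamp t w p true = 0.
  by rewrite tamp_disjoint // xpair_eqE andbF.
transitivity (tamp t w p false ^+ 2 * (amp T k' S false q * amp T k' S false q') +
  tamp t w p true ^+ 2 * (amp T k' S true q * amp T k' S true q') +
  tamp t w p false * tamp t w p true * (amp T k' S false q * amp T k' S true q' +
     amp T k' S true q * amp T k' S false q')); first by ring.
by rewrite !IH d !mulr0 mul0r !addr0.
Qed.

(** The first word fixes [p], and then the bits propagate to the right. A first tile is required:
    the empty product is the identity, with both diagonal entries nonzero. *)
Lemma amp_disjoint t T k S p q p' q' : (p, q) != (p', q') ->
  amp (t :: T) k S p q * amp (t :: T) k S p' q' = 0.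
Proof.
move=> ne; have [ep|np] := eqVneq p p'.
  by rewrite ep; apply: amp_disjoint_right; move: ne; rewrite ep xpair_eqE eqxx.
rewrite /=; set w := wrd _ _ _; set k' := (k + _)%N.
have d r r' : tamp t w p r * tamp t w p' r' = 0.
  by apply: tamp_disjoint; rewrite xpair_eqE (negbTE np).
transitivity (\sum_r \sum_r' (tamp t w p r * tamp t w p' r') *
  (amp T k' S r q * amp T k' S r' q')); first by rewrite !big_bool /=; ring.
by rewrite big1 // => r _; rewrite big1 // => r' _; rewrite d mul0r.
Qed.

Definition tparity T : bool := odd (sumn [seq count id (word t) | t <- T]).

(** Within a tile, each set bit changes the particle number by an odd amount: [100] turns into [011]
    or [000]. The inner bonds are counted twice and cancel. *)
Lemma amp_parity T k S p q : amp T k S p q != 0 ->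
  odd (count id (wrd S k (tiles_len T))) = tparity T (+) p (+) q.
Proof.
elim: T k p => [|t T IH] k p /=.
  by case: p q => [] []; rewrite ?eqxx.
rewrite tiles_len_cons wrdD count_cat oddD /tparity /= oddD -/(tparity T).
set w := wrd _ _ _; set k' := (k + _)%N.
have h r : tamp t w p r * amp T k' S r q != 0 ->
    odd (count id w) (+) odd (count id (wrd S k' (tiles_len T))) =
    odd (count id (word t)) (+) tparity T (+) p (+) q.
  rewrite mulf_eq0 negb_or => /andP[ht /IH ->].
  have -> : odd (count id w) = odd (count id (word t)) (+) p (+) r.
    move: ht; rewrite /tamp; case: (w =P tword t p r) => [->|_]; last by rewrite mulr0 eqxx.
    by case: t p r {IH} w k' => [] [] [] //=; rewrite ?mul0r ?eqxx.
  by case: (odd _); case: (tparity T); case: (p); case: (q); case: (r).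
have [e|/h //] := eqVneq (tamp t w p true * amp T k' S true q) 0.
by rewrite e addr0 => /h.
Qed.

Lemma sum_wrd_eq k n (w : seq bool) (c : R) : (k + n <= N)%N -> size w = n ->
  \sum_(S : conf | S \subset seg k (k + n)) c * (wrd S k n == w)%:R = c.
Proof.
move=> kn sw.
pose S0 : conf := [set x : 'I_N | (k <= x < k + n)%N && nth false w (x - k)].
have sS0 : S0 \subset seg k (k + n) by apply/subsetP => x; rewrite !inE => /andP[].
rewrite (bigD1 S0) //= big1 ?addr0.
  rewrite (_ : wrd S0 k n = w) ?eqxx ?mulr1 //.
  apply: (@eq_from_nth _ false); rewrite size_wrd // => i i_n.
  rewrite nth_wrd //; have kiN : (k + i < N)%N by lia.
  by rewrite (occ_ord S0 (Ordinal kiN)) inE /= addKn; case: nth; lia.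
move=> S /andP[sS neS]; case: eqP => [e|]; rewrite ?mulr0 //.
case/eqP: neS; apply/setP => x; rewrite inE -(occ_ord S).
case: (boolP (k <= x < k + n)%N) => [h|h] /=; last first.
  by apply: contraNF h; rewrite occ_ord => /(subsetP sS); rewrite inE.
by rewrite -e nth_wrd ?subnKC //; lia.
Qed.

Definition tweight t p q : R := normc (tcoef t p q) ^+ 2.

(** The matrix product of the squared moduli of [tcoef]: the norm counterpart of [amp]. *)
Fixpoint weight T p q : R :=
  if T is t :: T' then
    tweight t p false * weight T' false q + tweight t p true * weight T' true q
  else (p == q)%:R.

Lemma normcD_sqr (x y : C) : x * y = 0 ->
  normc (x + y) ^+ 2 = normc x ^+ 2 + normc y ^+ 2.
Proof.
by move=> /eqP; rewrite mulf_eq0 => /orP[] /eqP ->;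
  rewrite ?add0r ?addr0 Normc.normc0 expr0n /= ?add0r ?addr0.
Qed.

(** By [tamp_disjoint] the two summands of [amp] never overlap, so squared moduli add without cross
    terms, and the sum over configurations factors tile by tile. *)
Lemma sum_amp_sqr T k p q : (k + tiles_len T <= N)%N ->
  \sum_(S : conf | S \subset seg k (k + tiles_len T)) normc (amp T k S p q) ^+ 2 =
  weight T p q.
Proof.
elim: T k p => [|t T IH] k p kT.
  rewrite (bigD1 set0) ?sub0set //= big1 ?addr0.
    by case: eqP; rewrite ?Normc.normc1 ?Normc.normc0 ?expr1n ?expr0n.
  move=> S /andP[+ /negbTE neS]; rewrite addn0 => /subsetP sS.
  case/negP: (negbT neS); apply/eqP/setP => x; rewrite inE; apply/negP => /sS.
  by rewrite inE; lia.
rewrite tiles_len_cons in kT *; set n := size _; set m := tiles_len T.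
have dis : [disjoint seg k (k + n) & seg (k + n) (k + n + m)].
  by rewrite -setI_eq0; apply/eqP/setP => x; rewrite !inE; lia.
have -> : seg k (k + (n + m)) = seg k (k + n) :|: seg (k + n) (k + n + m).
  by apply/setP => x; rewrite !inE; lia.
have tI S r : normc (tamp t (wrd S k n) p r * amp T (k + n) S r q) ^+ 2 =
   tweight t p r * (wrd (S :&: seg k (k + n)) k n == tword t p r)%:R *
   normc (amp T (k + n) (S :&: seg (k + n) (k + n + m)) r q) ^+ 2.
  rewrite wrd_setI // amp_setI // Normc.normcM exprMn; congr (_ * _).
  rewrite /tamp Normc.normcM exprMn; congr (_ * _).
  by case: eqP; rewrite ?Normc.normc1 ?Normc.normc0 ?expr1n ?expr0n.
transitivity (\sum_r tweight t p r * weight T r q); last by rewrite big_bool /= addrC.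
transitivity (\sum_r \sum_(S : conf | S \subset seg k (k + n) :|: seg (k + n) (k + n + m))
   normc (tamp t (wrd S k n) p r * amp T (k + n) S r q) ^+ 2).
  rewrite exchange_big; apply: eq_bigr => S _; rewrite big_bool /= addrC -normcD_sqr //.
  by rewrite mulrACA tamp_disjoint ?mul0r // xpair_eqE andbF.
apply: eq_bigr => r _; under eq_bigr do rewrite tI.
rewrite (@sum_subsets_setU _ _ _ _
  (fun S => tweight t p r * (wrd S k n == tword t p r)%:R)
  (fun S => normc (amp T (k + n) S r q) ^+ 2)) //.
by rewrite IH ?sum_wrd_eq ?size_tword //; lia.
Qed.

(** * The VMD state in terms of the amplitudes *)

Fixpoint tiling_amp D k S : C :=
  if D is t :: D' then
    (if has_lambda t then lam else 1) * (wrd S k (size (word t)) == word t)%:R *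
    tiling_amp D' (k + size (word t)) S
  else 1.

(** Derived tilings correspond to sequences of bond bits: a dimer over two monomers spells [011] on
    the first and [000] on the second, and a truncated dimer closes with the shorter zero word of a
    right monomer. *)
Lemma sum_derive_amp T k S :
  \sum_(D <- derive T) tiling_amp D k S = amp T k S false false.
Proof.
have [n] := ubnP (size T); elim: n T k => // n IH [|t T] k sT.
  by rewrite big_seq1.
have hcons t' : \sum_(D <- [seq t' :: s | s <- derive T]) tiling_amp D k S =
    tamp t' (wrd S k (size (word t'))) false false *
    amp T (k + size (word t')) S false false.
  by rewrite big_map /= -big_distrr /= IH.
have [->|neM] : t = Mono \/ t <> Mono by case: (t); (by left) || by right.
  case: T sT hcons => [|t' T] sT hcons.
    by rewrite hcons /= /tamp /= !mulr0 addr0.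
  have hT k' : \sum_(D <- derive T) tiling_amp D k' S = amp T k' S false false.
    by apply: IH; move: sT => /=; lia.
  have -> : derive (Mono :: t' :: T) = [seq Mono :: s | s <- derive (t' :: T)] ++
      match t' with
      | Mono => [seq Dimer :: s | s <- derive T]
      | R1Mono => [seq T1Dimer :: s | s <- derive T]
      | R2Mono => [seq T2Dimer :: s | s <- derive T]
      | _ => [::]
      end by case: t' {sT hcons}; rewrite ?cats0.
  (* The new tile [t2] covers a monomer and a closing tile of length [m]; its word splits
     accordingly. *)
  have joined t2 m : size (word t2) = (3 + m)%N -> has_lambda t2 ->
      word t2 = [:: false; true; true] ++ nseq m false ->
      \sum_(D <- [seq t2 :: s | s <- derive T]) tiling_amp D k S =
      (wrd S k 3 == [:: false; true; true])%:R *
      (lam * (wrd S (k + 3) m == nseq m false)%:R * amp T (k + 3 + m) S false false).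
    move=> sz hl wE; rewrite big_map /= hl -big_distrr /= hT sz addnA.
    by rewrite wE wrdD eqseq_cat ?size_wrd // -mulnb natrM; ring.
  rewrite big_cat /= hcons [RHS]/= -/(amp (t' :: T)); congr (_ + _).
  rewrite /tamp [tcoef t' true true]/= mul0r mul0r addr0 [tcoef Mono _ _]/= mul1r.
  case: t' {sT hcons} => /=; rewrite ?big_nil ?(mul0r, mulr0) //.
  - exact: (joined Dimer 3).
  - exact: (joined T1Dimer 1%N).
  - exact: (joined T2Dimer 2).
have -> : derive (t :: T) = [seq t :: s | s <- derive T] by case: t neM {sT hcons}.
rewrite hcons /= [tamp t _ false true]/tamp.
have -> : tcoef t false true = 0 by case: t neM {sT hcons}.
by rewrite !mul0r addr0.
Qed.

Lemma tiling_amp_local D k S S' : (forall i, (k <= i)%N -> occ S i = occ S' i) ->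
  tiling_amp D k S = tiling_amp D k S'.
Proof.
elim: D k => [//|t D IH] k h /=; rewrite (@eq_wrd S S'); last first.
  by move=> i /andP[ki _]; apply: h.
by rewrite (IH (k + size (word t))%N) // => i hi; apply: h; lia.
Qed.

(** Operators in increasing order act with the highest site first, so each particle is created to
    the left of all those present, and every Jordan-Wigner sign is 1. *)
Lemma mono_create (b : nat) (xs : seq 'I_N) (phi : fk) S :
  (forall S, phi S != 0 -> S :&: seg 0 b = set0) ->
  all (fun x : 'I_N => (x < b)%N) xs -> sorted (fun x y : 'I_N => (x < y)%N) xs ->
  mono [seq (true, x) | x <- xs] phi S =
  (S :&: seg 0 b == [set x in xs])%:R * phi (S :\: [set x in xs]).
Proof.
move=> hphi; elim: xs S => [|x xs IH] S /=.
  have -> : [set x in [::]] = set0 :> conf by apply/setP => x; rewrite !inE.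
  rewrite setD0; case: eqP => [_|ne] _ _; first by rewrite mul1r.
  rewrite mul0r; apply/eqP; apply: contraT => /hphi /eqP.
  by move/eqP.
move=> /andP[xb hxs] srt.
have /allP xmin := order_path_min (fun y x z : 'I_N => @ltn_trans y x z) srt.
have xnot : x \notin xs by apply/negP => /xmin; rewrite ltnn.
rewrite mono_cons /= /cdag; case: ifP => xS; last first.
  rewrite (_ : _ == _ = false) ?mul0r //; apply/negP => /eqP /setP /(_ x).
  by rewrite !inE xS eqxx.
rewrite IH ?(path_sorted srt) //.
have -> : [set y in x :: xs] = x |: [set y in xs] :> conf by apply/setP => y; rewrite !inE.
have -> : ((S :\ x) :&: seg 0 b == [set y in xs]) = (S :&: seg 0 b == x |: [set y in xs]).
  apply/eqP/eqP => e.
    rewrite -e; apply/setP => y; rewrite !inE.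
    by case: (eqVneq y x) => [->|]//=; rewrite xS xb.
  apply/setP => y; have := congr1 (fun A : conf => y \in A) e; rewrite !inE.
  by case: (eqVneq y x) => [-> _|]//=; rewrite (negbTE xnot).
case: eqP => [e|_]; last by rewrite !mul0r mulr0.
rewrite setDDl mulrA mulr1 mul1r jw_odd (_ : [set _ in _ | _] = set0) ?cards0 ?mul1r //.
apply/setP => y; rewrite !inE; apply/negP => /andP[/andP[yx yS] ltyx].
have : y \in S :&: seg 0 b by rewrite !inE yS /=; lia.
by rewrite e !inE (negbTE yx) /= => /xmin; lia.
Qed.

Definition tile_sites k t : seq 'I_N :=
  pmap insub [seq (k + i)%N | i <- iota 0 (size (word t)) & nth false (word t) i].

Lemma tile_opE k t (phi : fk) S : tile_op lam k t phi S =
  (if has_lambda t then lam else 1) * mono [seq (true, x) | x <- tile_sites k t] phi S.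
Proof.
rewrite /tile_op /tile_sites; congr (_ * mono _ _ _).
by elim: [seq _ <- _ | _] => //= i s ->; case: insub.
Qed.

Lemma mem_tile_sites k t (x : 'I_N) :
  (x \in tile_sites k t) = (k <= x < k + size (word t))%N && nth false (word t) (x - k).
Proof.
rewrite /tile_sites mem_pmap_sub /=; apply/mapP/idP => [[m]|/andP[h hx]].
  by rewrite mem_filter mem_iota => /andP[hi h] ->; rewrite addKn hi; lia.
by exists (x - k)%N; rewrite ?mem_filter ?mem_iota ?hx; lia.
Qed.

Lemma sorted_tile_sites k t : sorted (fun x y : 'I_N => (x < y)%N) (tile_sites k t).
Proof.
have -> : sorted (fun x y : 'I_N => (x < y)%N) (tile_sites k t) =
    sorted ltn [seq val x | x <- tile_sites k t] by rewrite sorted_map.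
rewrite /tile_sites pmap_filter; last exact: insubK.
apply: sorted_filter; first exact: ltn_trans.
rewrite sorted_map; apply: (@sub_sorted _ ltn); first by move=> i j /=; lia.
by apply: sorted_filter; [exact: ltn_trans|exact: iota_ltn_sorted].
Qed.

(** Tiles act from right to left, so those starting at [k] leave all earlier sites empty. This is
    the indicator factor, and it supplies the hypothesis of [mono_create] for the preceding tile. *)
Lemma tiling_op_vac D k S : (k + tiles_len D)%N = N ->
  tiling_op lam k D (@vac R N) S = (S :&: seg 0 k == set0)%:R * tiling_amp D k S.
Proof.
elim: D k S => [|t D IH] k S.
  rewrite /tiles_len /= addn0 => kN; rewrite mulr1 /opid /vac (_ : _ :&: _ = S).
    by case: eqP.
  by apply/setIidPl/subsetP => x _; rewrite inE kN ltn_ord.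
rewrite tiles_len_cons addnA => kN /=; rewrite /opmul tile_opE.
set n := size _ in kN *.
have xsb : all (fun x : 'I_N => (x < k + n)%N) (tile_sites k t).
  by apply/allP => x; rewrite mem_tile_sites => /andP[/andP[]].
rewrite (@mono_create (k + n)) //; last exact: sorted_tile_sites.
  2: by move=> S'; rewrite IH //; case: (S' :&: seg 0 (k + n) =P set0) => // _; rewrite mul0r eqxx.
rewrite IH //.
(* The occupied sites below [k + n] are exactly those of the tile: nothing before [k], and the word
   of [t] from [k] on. *)
have -> : (S :&: seg 0 (k + n) == [set x in tile_sites k t]) =
    (S :&: seg 0 k == set0) && (wrd S k n == word t).
  apply/eqP/andP => [e|[/eqP e /eqP ew]].
    have mE (x : 'I_N) : (x < k + n)%N -> (x \in S) = (x \in tile_sites k t).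
      by move=> xk; have := congr1 (fun A : conf => x \in A) e; rewrite !inE xk /= andbT.
    split; apply/eqP.
      apply/setP => x; rewrite !inE; apply/negP => /andP[xS xk].
      by move: xS; rewrite mE ?mem_tile_sites; lia.
    apply: (@eq_from_nth _ false); rewrite size_wrd // => i i_n.
    have kiN : (k + i < N)%N by lia.
    rewrite nth_wrd // (occ_ord S (Ordinal kiN)) mE /=; last by lia.
    by rewrite mem_tile_sites /= addKn; case: nth; lia.
  apply/setP => x; rewrite !inE mem_tile_sites -/n -ew.
  have := congr1 (fun A : conf => x \in A) e; rewrite !inE /=.
  case: (ltnP x k) => [xk|kx] /=; first by case: (x \in S) => //; lia.
  move=> _; case: (ltnP x (k + n)) => xn; rewrite ?andbF //= andbT.
  by rewrite nth_wrd ?subnKC // ?occ_ord //; lia.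
case: (boolP (S :&: seg 0 k == set0)) => [/eqP e|_]; last by rewrite !mul0r mulr0.
rewrite /= mul1r; case: (boolP (wrd S k n == word t)) => ew; last by rewrite !(mulr0, mul0r).
rewrite !mul1r mulr1; congr (_ * _).
have -> : (S :\: [set x in tile_sites k t]) :&: seg 0 (k + n) == set0.
  apply/eqP/setP => x; rewrite !inE mem_tile_sites -/n -(eqP ew).
  have := congr1 (fun A : conf => x \in A) e; rewrite !inE /=.
  case: (ltnP x k) => [xk|kx] /=; first by case: (x \in S) => //; lia.
  move=> _; case: (ltnP x (k + n)) => xn; rewrite ?andbF //= andbT.
  by rewrite nth_wrd ?subnKC // ?occ_ord ?andNb //; lia.
rewrite mul1r; apply: tiling_amp_local => i ki.
apply: eq_existsb => x; rewrite !inE mem_tile_sites -/n.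
case: (eqVneq (x : nat) i) => [->|]; rewrite ?andbF // !andbT.
by rewrite (_ : (k <= i < k + n)%N = false) //; lia.
Qed.

Lemma vmd_state_amp T S : tiles_len T = N ->
  vmd_state lam T S = amp T 0 S false false.
Proof.
move=> TN; rewrite -sum_derive_amp /vmd_state.
elim: (derive T) (derive_len T) => [|D r IH] /=; first by rewrite !big_nil.
move=> /andP[/eqP DT /IH]; rewrite !big_cons => ->; congr (_ + _).
rewrite tiling_op_vac ?add0n ?DT // (_ : _ :&: _ = set0) ?eqxx ?mul1r //.
by apply/setP => x; rewrite !inE andbF.
Qed.

End Amplitudes.

Arguments amp : simpl never.

(** * The transfer matrix *)

Section Weights.
Variables (R : realType) (lam : R[i]).
Local Notation weight := (@weight R lam).
Definition normc2 : R := Normc.normc lam ^+ 2.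
Local Notation x := normc2.

Lemma normc2_ge0 : 0 <= x.
Proof. exact: sqr_ge0. Qed.

Lemma weight_cons t T p q : weight (t :: T) p q =
  tweight lam t p false * weight T false q + tweight lam t p true * weight T true q.
Proof. by []. Qed.

Definition wdet (T : seq tile) : R :=
  weight T false false * weight T true true - weight T false true * weight T true false.

Lemma weight_ge0 T p q : 0 <= weight T p q.
Proof.
elim: T p => [|t T IH] p /=; first by rewrite ler0n.
by rewrite addr_ge0 // mulr_ge0 // sqr_ge0.
Qed.

Lemma tweight_Mono : (tweight lam Mono false false = 1) * (tweight lam Mono false true = 1) *
  (tweight lam Mono true false = x) * (tweight lam Mono true true = 0).
Proof.
by rewrite /tweight; do !split; rewrite /= ?(@Normc.normc1 R, @Normc.normc0 R) ?expr1n ?expr0n.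
Qed.

Lemma wdet_cons t T : wdet (t :: T) =
  (tweight lam t false false * tweight lam t true true -
   tweight lam t false true * tweight lam t true false) * wdet T.
Proof. by rewrite /wdet /=; ring. Qed.

Lemma wdet_nseq m : wdet (nseq m Mono) = (- x) ^+ m.
Proof.
elim: m => [|m IH]; first by rewrite /wdet /=; ring.
by rewrite [nseq _ _]/= wdet_cons IH !tweight_Mono [RHS]exprS mulr0 sub0r mul1r.
Qed.

(** Only a monomer can open a dimer, so any other tile has a zero right column and kills the
    determinant. *)
Lemma wdet_eq0 T : wdet T = 0 \/ T = nseq (size T) Mono.
Proof.
elim: T => [|t T IH]; first by right.
have [->|neM] : t = Mono \/ t <> Mono by case: (t); (by left) || by right.
  case: IH => [e|e]; first by left; rewrite wdet_cons e mulr0.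
  by right; rewrite /= -e.
left; rewrite wdet_cons /tweight.
have -> : tcoef lam t false true = 0 by case: t neM.
by rewrite /= Normc.normc0 expr0n /= mul0r mulr0 subr0 mul0r.
Qed.

Local Notation s := (Num.sqrt (4 * x + 1)).
Local Notation mu := ((1 + s) / 2).
Local Notation nu := ((1 - s) / 2).

Lemma sqrt_sqr : s ^+ 2 = 4 * x + 1.
Proof. by rewrite sqr_sqrtr // addr_ge0 ?ler01 // mulr_ge0 ?normc2_ge0 // ler0n. Qed.

(** Powers of the monomer matrix by its eigenvalues [mu] and [nu], a Binet formula; the factor [s]
    clears the denominator. *)
Lemma weight_nseq m (W := weight (nseq m Mono)) :
  [/\ s * W false false = mu * mu ^+ m - nu * nu ^+ m,
      s * W false true = mu ^+ m - nu ^+ m,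
      s * W true false = x * (mu ^+ m - nu ^+ m) &
      s * W true true = mu * nu ^+ m - nu * mu ^+ m].
Proof.
rewrite {}/W; move: (s) sqrt_sqr => s0 sE.
(* Taking [y = mu] as parameter removes the square root: all quantities become polynomials in
   [y]. *)
have [y [y1 y2 y3]] : exists y, [/\ (1 + s0) / 2 = y, (1 - s0) / 2 = 1 - y & s0 = 2 * y - 1].
  by exists ((1 + s0) / 2); split=> //; field.
have xE : x = y * (y - 1) by have := sE; rewrite y3 expr2; lra.
rewrite y1 y2 y3 xE {y1 y2 y3 sE}.
elim: m => [|m [h1 h2 h3 h4]]; first by rewrite /= !expr0; split; ring.
rewrite [nseq _ _]/= !weight_cons !tweight_Mono xE !mul1r !mul0r !addr0; split.
- by rewrite [LHS]mulrDr h1 h3 !exprS; ring.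
- by rewrite [LHS]mulrDr h2 h4 !exprS; ring.
- by rewrite [LHS]mulrCA h1 !exprS; ring.
- by rewrite [LHS]mulrCA h2 !exprS; ring.
Qed.

(** The modulus of the eigenvalue ratio [nu / mu]. *)
Definition decay : R := (s - 1) / (s + 1).

(** With [n = m + 1], the left side is the modulus of the determinant, [(mu * |nu|) ^ n], while the
    bracket is the permanent, of order [mu ^ (2 n)]. One power of [decay] is given up to absorb
    [s ^ 2 / x] and keep the constant independent of [lam]. *)
Lemma weight_prod_ge m (W := weight (nseq m.+1 Mono)) :
  x ^+ m.+1 <= 4 * decay ^+ m *
    (W false false * W true true + W false true * W true false).
Proof.
have [h1 h2 h3 h4] := weight_nseq m.+1; rewrite -/W in h1 h2 h3 h4.
have x0 := normc2_ge0.
have s1 : 1 <= s by rewrite -[leLHS]sqrtr1 ler_wsqrtr //; lra.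
rewrite /decay; move: (s) sqrt_sqr s1 h1 h2 h3 h4 => s0 sE s1.
(* Here [t = - nu], so that [mu = 1 + t], [x = mu * t] and [decay = t / mu] with [t] nonnegative. *)
have [t [t1 t2 t3]] : exists t, [/\ (1 + s0) / 2 = 1 + t, (1 - s0) / 2 = - t & s0 = 2 * t + 1].
  by exists ((s0 - 1) / 2); split=> //; field.
have t0 : 0 <= t by lra.
have xE : x = (1 + t) * t by have := sE; rewrite t3 expr2; lra.
rewrite t1 t2 t3 {t1 t2 sE s1 t3 s0} => h1 h2 h3 h4.
have mu0 : 1 + t != 0 by apply: lt0r_neq0; lra.
have -> : (2 * t + 1 - 1) / (2 * t + 1 + 1) = t / (1 + t).
  by field; rewrite mu0 /=; apply: lt0r_neq0; lra.
set s0 := 2 * t + 1 in h1 h2 h3 h4.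
set mu := 1 + t in h1 h2 h3 h4 mu0 xE *.
set P := _ + _ * _.
have PE : s0 ^+ 2 * P = 2 * x * ((mu ^+ m.+1) ^+ 2 + (t ^+ m.+1) ^+ 2) +
    mu ^+ m.+1 * (- t) ^+ m.+1.
  transitivity ((s0 * W false false) * (s0 * W true true) +
    (s0 * W false true) * (s0 * W true false)); first by rewrite /P; ring.
  rewrite h1 h2 h3 h4 xE /mu.
  have -> : (t ^+ m.+1) ^+ 2 = ((- t) ^+ m.+1) ^+ 2.
    by rewrite -!exprM ![(m.+1 * 2)%N]mulnC !exprM sqrrN.
  by set A := (1 + t) ^+ _; set B := (- t) ^+ _; ring.
(* The cross term has modulus [x ^ m.+1] and may be negative; it costs at most half of the leading
   term of [PE]. *)
have cross : - (x * (mu ^+ m.+1) ^+ 2) <= mu ^+ m.+1 * (- t) ^+ m.+1.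
  have : `|mu ^+ m.+1 * (- t) ^+ m.+1| <= x * (mu ^+ m.+1) ^+ 2.
    rewrite -exprMn mulrN normrX normrN -xE ger0_norm // exprS ler_wpM2l //.
    rewrite xE exprMn expr2 exprS; apply: ler_pM; rewrite ?exprn_ge0 // /mu; try lra.
      by rewrite ler_peMl ?exprn_ge0 //; lra.
    apply: (@le_trans _ _ ((1 + t) ^+ m)); first by rewrite lerXn2r ?nnegrE //; lra.
    by rewrite ler_peMl ?exprn_ge0 //; lra.
  by rewrite ler_norml => /andP[].
have low : x * (mu ^+ m.+1) ^+ 2 <= s0 ^+ 2 * P.
  rewrite PE; have : 0 <= x * (t ^+ m.+1) ^+ 2 by rewrite mulr_ge0 ?sqr_ge0.
  move: cross; set E3 := _ * (- t) ^+ _; set E1 := (mu ^+ _) ^+ 2; set E2 := (t ^+ _) ^+ 2.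
  rewrite -mulrA [x * (E1 + _)]mulrDr; move: (x * E1) (x * E2) E3 => a b c; lra.
have d0 : 0 <= (t / mu) ^+ m by rewrite exprn_ge0 // divr_ge0 // /mu; lra.
have s2 : 0 < s0 ^+ 2 by rewrite exprn_gt0 // /s0; lra.
rewrite -(ler_pM2l s2).
have -> : s0 ^+ 2 * (4 * (t / mu) ^+ m * P) = 4 * (t / mu) ^+ m * (s0 ^+ 2 * P) by ring.
apply: le_trans (ler_wpM2l _ low); last by rewrite mulr_ge0 // ler0n.
(* The constant 4 comes from comparing [s0 ^ 2] with [(2 * mu) ^ 2], as [s0 = 2 * mu - 1]. *)
have -> : 4 * (t / mu) ^+ m * (x * (mu ^+ m.+1) ^+ 2) = (2 * mu) ^+ 2 * x ^+ m.+1.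
  rewrite xE expr_div_n !exprMn !exprS expr0.
  set B := t ^+ m; set A := mu ^+ m; have A0 : A != 0 by rewrite expf_neq0.
  by field.
apply: ler_wpM2r; first by rewrite exprn_ge0.
by rewrite lerXn2r ?nnegrE // /s0 /mu; lra.
Qed.

(** [Z] is a sum of four nonnegative terms whose square dominates the permanent of [W] times
    [2 * K], so the ratio of determinant to permanent controls the claim. A product with a singular
    tile contributes zero. *)
Lemma wdet_bound (T : seq tile) m (U V : bool -> R) (W := weight T)
  (Z := \sum_p \sum_q U p * W p q * V q) :
  (forall p, 0 <= U p) -> (forall q, 0 <= V q) ->
  (forall n, T = nseq n Mono -> (m < n)%N) -> 0 <= decay <= 1 ->
  4 * (U false * U true * V false * V true) * `|wdet T| <= 8 * decay ^+ m * Z ^+ 2.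
Proof.
move=> U0 V0 hm /andP[d0 d1].
have rhs0 : 0 <= 8 * decay ^+ m * Z ^+ 2.
  apply: mulr_ge0; last exact: sqr_ge0.
  by apply: mulr_ge0; [exact: ler0n|exact: exprn_ge0].
case: (wdet_eq0 T) => [->|TE]; first by rewrite normr0 mulr0.
have := hm _ TE; case: (size T) TE => [//|n] TE mn.
rewrite TE wdet_nseq normrX normrN ger0_norm ?normc2_ge0 //.
pose P := W false false * W true true + W false true * W true false.
have wge : x ^+ n.+1 <= 4 * decay ^+ n * P by rewrite /P /W TE; apply: weight_prod_ge.
have W0 : forall p q, 0 <= W p q := weight_ge0 T.
set K := U false * _ * _ * _.
have K0 : 0 <= K by rewrite !mulr_ge0.
(* Two of the cross terms in the square of [Z] already give the permanent. *)
have KP : 2 * K * P <= Z ^+ 2.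
  rewrite /Z !big_bool /=.
  set z00 := U false * W false false * V false; set z11 := U true * W true true * V true.
  set z01 := U false * W false true * V true; set z10 := U true * W true false * V false.
  have -> : 2 * K * P = 2 * (z00 * z11) + 2 * (z01 * z10).
    by rewrite /K /P /z00 /z11 /z01 /z10; ring.
  have p00 : 0 <= z00 by rewrite !mulr_ge0.
  have p11 : 0 <= z11 by rewrite !mulr_ge0.
  have p01 : 0 <= z01 by rewrite !mulr_ge0.
  have p10 : 0 <= z10 by rewrite !mulr_ge0.
  have -> : (z11 + z10 + (z01 + z00)) ^+ 2 = 2 * (z00 * z11) + 2 * (z01 * z10) +
    (z00 ^+ 2 + z11 ^+ 2 + z01 ^+ 2 + z10 ^+ 2 +
     2 * (z00 * z01 + z00 * z10 + z11 * z01 + z11 * z10)) by ring.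
  by rewrite lerDl !addr_ge0 ?sqr_ge0 ?mulr_ge0 ?addr_ge0 ?mulr_ge0.
have Z20 : 0 <= Z ^+ 2 by apply: sqr_ge0.
apply: (@le_trans _ _ (8 * decay ^+ n * Z ^+ 2)); last first.
  by rewrite ler_wpM2r // ler_wpM2l // ler_wiXn2l.
apply: (@le_trans _ _ (8 * decay ^+ n * (2 * K * P))); last first.
  by rewrite ler_wpM2l // mulr_ge0 ?exprn_ge0.
have -> : 8 * decay ^+ n * (2 * K * P) = 4 * K * (4 * decay ^+ n * P) by ring.
by rewrite ler_wpM2l // mulr_ge0.
Qed.

End Weights.

Arguments weight : simpl never.

(** * Two-point correlations *)

Section Correlations.
Variables (R : realType) (N : nat) (lam : R[i]).
Local Notation C := R[i].
Local Notation conf := {set 'I_N}.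
Local Notation fk := (fock R N).
Local Notation normc := (@Normc.normc R).
Local Notation ops := (seq (C * seq (bool * 'I_N))).

Definition normsq (Z : conf) (f : fk) : R :=
  \sum_(S : conf | S \subset Z) normc (f S) ^+ 2.

Lemma normsq_ge0 Z f : 0 <= normsq Z f.
Proof. by apply: sumr_ge0 => S _; apply: sqr_ge0. Qed.

Lemma inn_self Z f : inn Z f f = (normsq Z f)%:C%C.
Proof. by rewrite rmorph_sum; apply: eq_bigr => S _; rewrite conjc_mul_normc. Qed.

Lemma inner_sum (I J : finType) (F : I -> fk) (G : J -> fk) :
  inner (fun S => \sum_i F i S) (fun S => \sum_j G j S) =
  \sum_i \sum_j inner (F i) (G j).
Proof.
rewrite /inner; under eq_bigr do rewrite rmorph_sum big_distrlr /=.
rewrite exchange_big; apply: eq_bigr => i _.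
by rewrite exchange_big.
Qed.

Lemma inner_sumZ (I : Type) (r : seq I) (c : I -> C) (f : fk) (G : I -> fk) :
  inner f (fun S => \sum_(i <- r) c i * G i S) = \sum_(i <- r) c i * inner f (G i).
Proof.
rewrite /inner; under eq_bigr do rewrite big_distrr /=.
rewrite exchange_big; apply: eq_bigr => i _; rewrite big_distrr.
by apply: eq_bigr => S _ /=; ring.
Qed.

(** The Cauchy-Binet identity for [(F W G)(U W V) - (F W V)(U W G)], where [Z = U W V]. *)
Lemma covariance_factor (F G : bool -> C) (U V : bool -> R) (W : bool -> bool -> R)
  (Z := \sum_p \sum_q U p * W p q * V q) : Z != 0 ->
  (\sum_p \sum_q F p * (W p q)%:C%C * G q) / Z%:C%C -
  (\sum_p \sum_q F p * (W p q)%:C%C * (V q)%:C%C) / Z%:C%C *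
    ((\sum_p \sum_q (U p)%:C%C * (W p q)%:C%C * G q) / Z%:C%C) =
  (F false * (U true)%:C%C - F true * (U false)%:C%C) *
  (W false false * W true true - W false true * W true false)%:C%C *
  (G false * (V true)%:C%C - G true * (V false)%:C%C) / (Z ^+ 2)%:C%C.
Proof.
move=> Z0.
have ZC0 : Z%:C%C != 0 :> C by rewrite -(rmorph0 (@real_complex R)) (inj_eq (@complexI R)).
rewrite rmorphXn; apply: (mulIf (expf_neq0 2 ZC0)).
rewrite divfK ?expf_neq0 // mulrBl mulf_div.
rewrite -expr2 divfK ?expf_neq0 // expr2 mulrA divfK //.
rewrite /Z !big_bool /= !(rmorphD, rmorphB, rmorphM).
by ring.
Qed.

(** * The state cut into a left, a middle and a right block *)

Section Decomposition.
Variables (T1 T2 T3 : seq tile) (t : tile).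
Let T := T1 ++ (t :: T2) ++ T3.
Hypothesis TN : tiles_len T = N.
Let a := tiles_len T1.
Let b := (a + tiles_len (t :: T2))%N.

Lemma lenT3 : (b + tiles_len T3)%N = N.
Proof. by rewrite -TN /T !tiles_len_cat /b addnA. Qed.

Let aN : (a <= N)%N. Proof. by have := lenT3; rewrite /b; lia. Qed.
Let ab : (a <= b)%N. Proof. by rewrite /b; lia. Qed.
Let bN : (b <= N)%N. Proof. by have := lenT3; lia. Qed.

(** The indicator confines the vector to its block, so that its parity can be measured by the full
    cardinality of the configuration. *)
Definition leftst p : fk := fun S => (S \subset seg N 0 a)%:R * amp lam T1 0 S false p.
Definition midst p q : fk := fun S => amp lam (t :: T2) a S p q.
Definition rightst q : fk := fun S => (S \subset seg N b N)%:R * amp lam T3 b S q false.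

Definition tsum (u : bool -> fk) (f : bool -> bool -> fk) (v : bool -> fk) : fk :=
  fun S => \sum_(i : bool * bool) tens3 a b (u i.1) (f i.1 i.2) (v i.2) S.

Lemma vmd_state_tsum : vmd_state lam T = tsum leftst midst rightst.
Proof.
apply/funext => S; rewrite vmd_state_amp // /T !amp_cat add0n -/a -/b.
rewrite /tsum -(pair_bigA _ (fun p q => tens3 a b (leftst p) (midst p q) (rightst q) S)) /=.
rewrite !big_bool /= /tens3 /leftst /rightst /midst !subsetIr !mul1r.
have := lenT3 => lT.
by rewrite !(@amp_setI _ _ _ T1) ?(@amp_setI _ _ _ (t :: T2)) ?(@amp_setI _ _ _ T3)
  ?lT //; ring.
Qed.

Lemma leftst_parity p : supp_parity (tparity T1 (+) p) (leftst p).
Proof.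
move=> S; rewrite /leftst; case: (boolP (S \subset _)) => sS; last by rewrite mul0r eqxx.
rewrite mul1r => /amp_parity; rewrite addbF count_wrd ?add0n //.
by rewrite (setIidPl sS).
Qed.

Lemma rightst_parity q : supp_parity (tparity T3 (+) q) (rightst q).
Proof.
move=> S; rewrite /rightst; case: (boolP (S \subset _)) => sS; last by rewrite mul0r eqxx.
rewrite mul1r => /amp_parity; rewrite addbF count_wrd ?lenT3 //.
by rewrite (setIidPl sS).
Qed.

Definition left_local (ws : ops) :=
  all (fun l => all (fun l : bool * 'I_N => (l.2 < a)%N) l.2) ws.
Definition right_local (ws : ops) :=
  all (fun l => all (fun l : bool * 'I_N => (b <= l.2)%N) l.2) ws.
Definition has_parity (p : bool) (ws : ops) := all (fun l => odd (size l.2) == p) ws.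

Lemma lincomb_tsuml ws u f v : left_local ws ->
  lincomb ws (tsum u f v) = tsum (fun p => lincomb ws (u p)) f v.
Proof.
move=> h; rewrite /tsum lincomb_sum; apply/funext => S; apply: eq_bigr => i _.
by rewrite lincomb_tens3l.
Qed.

Lemma lincomb_tsumr p ws u f v : right_local ws -> has_parity p ws ->
  lincomb ws (tsum u f v) = tsum (fun r => twist p (u r)) (fun r s => twist p (f r s))
    (fun s => lincomb ws (v s)).
Proof.
move=> h hp; rewrite /tsum lincomb_sum; apply/funext => S; apply: eq_bigr => i _.
rewrite (@lincomb_tens3r _ _ _ _ _ _ p) //.
by apply/allP => l lw; rewrite (allP h _ lw) (allP hp _ lw).
Qed.

(** Middle factors with different bits have disjoint supports, and a twist changes only signs, so
    just the diagonal terms survive. *)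
Lemma inner_tsum (c : bool) u v :
  inner (vmd_state lam T) (tsum u (fun p q => twist c (midst p q)) v) =
  \sum_p \sum_q inn (seg N 0 a) (leftst p) (u p) *
    inn (seg N a b) (midst p q) (twist c (midst p q)) * inn (seg N b N) (rightst q) (v q).
Proof.
rewrite vmd_state_tsum /tsum inner_sum [RHS]pair_big /=; apply: eq_bigr => -[p q] _ /=.
rewrite (bigD1 (p, q)) //= big1 ?addr0; first by rewrite inner_tens3.
move=> [p' q'] /= ne; rewrite inner_tens3 //.
rewrite [X in _ * X * _](_ : _ = 0) ?mulr0 ?mul0r //; apply: big1 => S _.
rewrite /twist mulrCA; apply/eqP; rewrite mulf_eq0; apply/orP; right.
have := @amp_disjoint _ _ lam t T2 a S p q p' q'; rewrite eq_sym => /(_ ne) /eqP.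
rewrite mulf_eq0 /midst => /orP[] /eqP ->; first by rewrite conjc0 mul0r.
by rewrite mulr0.
Qed.

Lemma inn_midst p q : inn (seg N a b) (midst p q) (midst p q) = (weight lam (t :: T2) p q)%:C%C.
Proof. by rewrite inn_self /normsq sum_amp_sqr. Qed.

Lemma inner_even u v : inner (vmd_state lam T) (tsum u midst v) =
  \sum_p \sum_q inn (seg N 0 a) (leftst p) (u p) *
    (weight lam (t :: T2) p q)%:C%C * inn (seg N b N) (rightst q) (v q).
Proof.
have e : (fun p q => twist false (midst p q)) = midst.
  by apply/funext => p; apply/funext => q; rewrite twist0.
rewrite -e inner_tsum; apply: eq_bigr => p _; apply: eq_bigr => q _.
by rewrite twist0 inn_midst.
Qed.

(** Filling the other blocks with the vacuum turns [u] into a vector on the whole lattice, where the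
    operator norm applies. *)
Lemma inn_left_le ws u : left_local ws ->
  normc (inn (seg N 0 a) u (lincomb ws u)) <= opnorm (lincomb ws) * normsq (seg N 0 a) u.
Proof.
move=> h; have := inner_op_le ws (tens3 a b u (@vac R N) (@vac R N)).
rewrite lincomb_tens3l // inner_tens3 // !inn_vac !mulr1.
suff -> : vnorm (tens3 a b u (@vac R N) (@vac R N)) ^+ 2 = normsq (seg N 0 a) u by [].
by apply: (@complexI R); rewrite -inner_self inner_tens3 // !inn_vac !mulr1 inn_self.
Qed.

Lemma inn_right_le ws v : right_local ws -> has_parity false ws ->
  normc (inn (seg N b N) v (lincomb ws v)) <= opnorm (lincomb ws) * normsq (seg N b N) v.
Proof.
move=> h hp; have := inner_op_le ws (tens3 a b (@vac R N) (@vac R N) v).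
rewrite (@lincomb_tens3r _ _ _ _ _ _ false) //; last first.
  by apply/allP => l lw; rewrite (allP h _ lw) (allP hp _ lw).
rewrite !twist0 inner_tens3 // !inn_vac !mul1r.
suff -> : vnorm (tens3 a b (@vac R N) (@vac R N) v) ^+ 2 = normsq (seg N b N) v by [].
by apply: (@complexI R); rewrite -inner_self inner_tens3 // !inn_vac !mul1r inn_self.
Qed.

(** The right observable only twists the left factor, which keeps its parity; the odd observable
    then reverses that parity, and opposite parities are orthogonal. *)
Lemma odd_left_zero ws ws' : left_local ws -> has_parity true ws -> right_local ws' ->
  inner (vmd_state lam T) (lincomb ws (lincomb ws' (vmd_state lam T))) = 0.
Proof.
(* The observable [ws'] may mix parities, so it is expanded into monomials, each with a definite
   twist. *)
move=> hl ho hr; rewrite [lincomb ws' _]/lincomb.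
rewrite -/(fock R N) lincomb_sumZ inner_sumZ big_seq big1 // => l lw'.
have -> : mono l.2 (vmd_state lam T) = lincomb [:: (1, l.2)] (vmd_state lam T).
  by apply/funext => S; rewrite /lincomb big_seq1 mul1r.
rewrite {2}vmd_state_tsum (@lincomb_tsumr (odd (size l.2))); last 2 first.
- by rewrite /right_local /= andbT (allP hr).
- by rewrite /has_parity /= eqxx.
rewrite lincomb_tsuml // inner_tsum big1 ?mulr0 // => p _; rewrite big1 // => q _.
rewrite [inn _ _ _](_ : _ = 0) ?mul0r //.
apply: (@supp_parity_mul0 _ _ (tparity T1 (+) p) (true (+) (tparity T1 (+) p))).
- by case: (_ (+) _).
- exact: leftst_parity.
- by apply: lincomb_parity => //; apply/twist_parity/leftst_parity.
Qed.

Lemma odd_right_zero ws ws' : right_local ws -> has_parity true ws -> left_local ws' ->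
  inner (vmd_state lam T) (lincomb ws (lincomb ws' (vmd_state lam T))) = 0.
Proof.
move=> hr ho hl; rewrite {2}vmd_state_tsum lincomb_tsuml // (lincomb_tsumr _ _ _ hr ho).
rewrite inner_tsum big1 // => p _; rewrite big1 // => q _.
rewrite [X in _ * X](_ : _ = 0) ?mulr0 //.
apply: (@supp_parity_mul0 _ _ (tparity T3 (+) q) (true (+) (tparity T3 (+) q))).
- by case: (_ (+) _).
- exact: rightst_parity.
- by apply: lincomb_parity => //; apply: rightst_parity.
Qed.

Let U p := normsq (seg N 0 a) (leftst p).
Let V q := normsq (seg N b N) (rightst q).
Let W := weight lam (t :: T2).
Let Z : R := \sum_p \sum_q U p * W p q * V q.

Lemma inner_state : inner (vmd_state lam T : fk) (vmd_state lam T) = Z%:C%C.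
Proof.
rewrite {2}vmd_state_tsum inner_even /Z rmorph_sum; apply: eq_bigr => p _.
rewrite rmorph_sum; apply: eq_bigr => q _.
by rewrite !rmorphM !inn_self.
Qed.

(** Each of the two minors is at most twice the operator norm times a product of squared norms,
    which explains the factor 4. The product is an abstract [A12] so that both orders of
    multiplication are covered. *)
Lemma covariance_bound (A12 : op R N) ws ws' (K : R) :
  left_local ws -> right_local ws' -> has_parity false ws' ->
  A12 (vmd_state lam T) = tsum (fun p => lincomb ws (leftst p)) midst
    (fun q => lincomb ws' (rightst q)) ->
  0 <= K ->
  4 * (U false * U true * V false * V true) * `|wdet lam (t :: T2)| <= K * Z ^+ 2 ->
  normc (omega lam T A12 - omega lam T (lincomb ws) * omega lam T (lincomb ws')) <=
  opnorm (lincomb ws) * opnorm (lincomb ws') * K.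
Proof.
move=> hl hr hp hA K0 hK.
rewrite /omega inner_state hA.
have -> : lincomb ws (vmd_state lam T) = tsum (fun p => lincomb ws (leftst p)) midst rightst.
  by rewrite vmd_state_tsum lincomb_tsuml.
have -> : lincomb ws' (vmd_state lam T) = tsum leftst midst (fun q => lincomb ws' (rightst q)).
  rewrite vmd_state_tsum (lincomb_tsumr _ _ _ hr hp) /tsum; apply/funext => S.
  by apply: eq_bigr => i _; rewrite !twist0.
set n1 := opnorm (lincomb ws); set n2 := opnorm (lincomb ws').
have n10 : 0 <= n1 by apply: opnorm_ge0.
have n20 : 0 <= n2 by apply: opnorm_ge0.
rewrite !inner_even; under [X in _ - _ / _ * (X / _)]eq_bigr do under eq_bigr do rewrite inn_self.
under [X in _ - X / _ * _]eq_bigr do under eq_bigr do rewrite inn_self.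
pose F p := inn (seg N 0 a) (leftst p) (lincomb ws (leftst p)).
pose G q := inn (seg N b N) (rightst q) (lincomb ws' (rightst q)).
(* Division by zero yields zero, so every expectation vanishes in the degenerate case. *)
have [Z0|Z0] := eqVneq Z 0.
  by rewrite Z0 invr0 !mulr0 subrr Normc.normc0 !mulr_ge0.
have F0 p : normc (F p) <= n1 * U p by apply: inn_left_le.
have G0 q : normc (G q) <= n2 * V q by apply: inn_right_le.
set num := (X in normc X).
have -> : num = (F false * (U true)%:C%C - F true * (U false)%:C%C) *
   (wdet lam (t :: T2))%:C%C *
   (G false * (V true)%:C%C - G true * (V false)%:C%C) / (Z ^+ 2)%:C%C.
  exact: covariance_factor.
rewrite !Normc.normcM Normc.normcV !normc_realE [`|Z ^+ 2|]ger0_norm ?sqr_ge0 //.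
have Z2 : 0 < Z ^+ 2 by rewrite lt_neqAle sqr_ge0 eq_sym expf_neq0.
rewrite ler_pdivrMr //.
have U0 p : 0 <= U p by apply: normsq_ge0.
have V0 q : 0 <= V q by apply: normsq_ge0.
have hF : normc (F false * (U true)%:C%C - F true * (U false)%:C%C) <=
   2 * n1 * (U false * U true).
  apply: le_trans (normcB _ _) _; rewrite !Normc.normcM !normc_real //.
  have -> : 2 * n1 * (U false * U true) = n1 * U false * U true + n1 * U true * U false by ring.
  by apply: lerD; apply: ler_wpM2r.
have hG : normc (G false * (V true)%:C%C - G true * (V false)%:C%C) <=
   2 * n2 * (V false * V true).
  apply: le_trans (normcB _ _) _; rewrite !Normc.normcM !normc_real //.
  have -> : 2 * n2 * (V false * V true) = n2 * V false * V true + n2 * V true * V false by ring.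
  by apply: lerD; apply: ler_wpM2r.
apply: (@le_trans _ _ (2 * n1 * (U false * U true) * `|wdet lam (t :: T2)| *
    (2 * n2 * (V false * V true)))).
  apply: ler_pM; rewrite ?mulr_ge0 ?normc_ge0 //.
  by apply: ler_wpM2r.
have -> : 2 * n1 * (U false * U true) * `|wdet lam (t :: T2)| * (2 * n2 * (V false * V true)) =
  n1 * n2 * (4 * (U false * U true * V false * V true) * `|wdet lam (t :: T2)|) by ring.
by rewrite -[leRHS]mulrA ler_wpM2l // mulr_ge0.
Qed.

Lemma decorrelation ws ws' m :
  left_local ws -> has_parity false ws -> right_local ws' -> has_parity false ws' ->
  (forall n, t :: T2 = nseq n Mono -> (m < n)%N) -> 0 <= decay lam <= 1 ->
  (normc (omega lam T (opmul (lincomb ws) (lincomb ws')) -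
     omega lam T (lincomb ws) * omega lam T (lincomb ws')) <=
   opnorm (lincomb ws) * opnorm (lincomb ws') * (8 * decay lam ^+ m)) /\
  (normc (omega lam T (opmul (lincomb ws') (lincomb ws)) -
     omega lam T (lincomb ws) * omega lam T (lincomb ws')) <=
   opnorm (lincomb ws) * opnorm (lincomb ws') * (8 * decay lam ^+ m)).
Proof.
move=> hl hp hr hp' hm hd.
have K0 : 0 <= 8 * decay lam ^+ m.
  by rewrite mulr_ge0 ?ler0n // exprn_ge0 //; case/andP: hd.
have K1 : 4 * (U false * U true * V false * V true) * `|wdet lam (t :: T2)| <=
    8 * decay lam ^+ m * Z ^+ 2.
  by apply: wdet_bound => // p; apply: normsq_ge0.
by split; apply: covariance_bound => //; rewrite /opmul vmd_state_tsum;
  rewrite ?(lincomb_tsumr _ _ _ hr hp') lincomb_tsuml // ?(lincomb_tsumr _ _ _ hr hp');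
  rewrite /tsum; apply/funext => S; apply: eq_bigr => i _; rewrite !twist0.
Qed.

End Decomposition.
End Correlations.

(** * Distances and decay rate *)

Lemma tile_at (T : seq tile) j : (j < tiles_len T)%N ->
  exists T1 t T2, T = T1 ++ t :: T2 /\ (tiles_len T1 <= j < tiles_len T1 + size (word t))%N.
Proof.
elim: T j => [//|t T IH] j; rewrite tiles_len_cons => hj.
case: (ltnP j (size (word t))) => [h|h]; first by exists [::], t, T.
have [|T1 [t' [T2 [-> h']]]] := IH (j - size (word t))%N; first by lia.
by exists (t :: T1), t', T2; split => //; rewrite tiles_len_cons; lia.
Qed.

Lemma size_word_le t : (size (word t) <= 6)%N.
Proof. by case: t. Qed.

(** The tiles covering [i] and [j] are assigned to the outer parts. Each has at most 6 sites, so at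
    most 11 sites of the gap are lost and the middle part is nonempty. *)
Lemma tiling_split (T : seq tile) i j : (i + 20 <= j < tiles_len T)%N ->
  exists T1 t T2 T3, [/\ T = T1 ++ (t :: T2) ++ T3, (i < tiles_len T1)%N,
    (tiles_len T1 + tiles_len (t :: T2) <= j)%N &
    (j <= i + tiles_len (t :: T2) + 11)%N].
Proof.
move=> /andP[ij jT].
have [|T1 [t1 [T' [TE h1]]]] := @tile_at T i; first by lia.
have e1 := size_word_le t1.
rewrite TE -cat1s catA tiles_len_cat in jT.
have l1 : tiles_len (T1 ++ [:: t1]) = (tiles_len T1 + size (word t1))%N.
  by rewrite tiles_len_cat tiles_len_cons addn0.
have [|M [t3 [T3 [T'E h3]]]] := @tile_at T' (j - tiles_len (T1 ++ [:: t1]))%N; first by lia.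
have e3 := size_word_le t3.
case: M T'E h3 => [|t M] T'E h3; first by rewrite (_ : tiles_len [::] = 0%N) // in h3; lia.
exists (T1 ++ [:: t1]), t, M, (t3 :: T3); split.
- by rewrite TE T'E -catA.
- by lia.
- by lia.
- by lia.
Qed.

Lemma bigminn_le (I : eqType) (r : seq I) (P : pred I) (f : I -> nat) n i :
  i \in r -> P i -> (\big[minn/n]_(k <- r | P k) f k <= f i)%N.
Proof.
move=> + Pi; elim: r => [//|k r IH]; rewrite inE big_cons => /predU1P[<-|/IH h].
  by rewrite Pi geq_minl.
by case: ifP => // _; apply: leq_trans (geq_minr _ _) h.
Qed.

Lemma sdist_le N (X Y : {set 'I_N}) (x y : 'I_N) : x \in X -> y \in Y ->
  (sdist X Y <= `|(x : int) - (y : int)|)%N.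
Proof.
move=> xX yY; rewrite /sdist.
apply: leq_trans (bigminn_le _ _ (mem_index_enum x) xX) _.
exact: (bigminn_le _ _ (mem_index_enum y) yY).
Qed.

Lemma sdist_interval N i1 i2 j1 j2 (d := sdist (site_interval N i1 i2) (site_interval N j1 j2)) :
  (i1 <= i2 < N)%N -> (j1 <= j2 < N)%N -> (0 < d)%N ->
  (i2 + d <= j1)%N \/ (j2 + d <= i1)%N.
Proof.
move=> hX hY d0.
have mem k i j (kN : (k < N)%N) : (i <= k <= j)%N -> Ordinal kN \in site_interval N i j.
  by move=> h; rewrite inE.
have le x y : (i1 <= x <= i2)%N -> (j1 <= y <= j2)%N -> (d <= (x - y) + (y - x))%N.
  move=> hx hy; have xN : (x < N)%N by lia.
  have yN : (y < N)%N by lia.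
  have := sdist_le (mem _ _ _ xN hx) (mem _ _ _ yN hy); rewrite -/d /=; lia.
case: (ltnP i2 j1) => h; first by left; have := le i2 j1; lia.
case: (ltnP j2 i1) => h'; first by right; have := le i1 j2; lia.
(* Overlapping intervals share the larger of their left ends, which would force distance zero. *)
by have := le (maxn i1 j1) (maxn i1 j1); lia.
Qed.

Section Decay.
Variables (R : realType) (lam : R[i]).
Hypothesis lam0 : lam != 0.

Lemma sqrt_gt1 : 1 < Num.sqrt (4 * normc2 lam + 1).
Proof.
rewrite -[ltLHS]sqrtr1 ltr_sqrt; last by have := normc2_ge0 lam; lra.
have : 0 < normc2 lam; last by lra.
rewrite exprn_gt0 // lt_neqAle normc_ge0 andbT eq_sym.
by apply: contraNneq lam0 => /Normc.eq0_normc ->.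
Qed.

Lemma decay_itv : 0 <= decay lam <= 1.
Proof.
have s1 := sqrt_gt1; rewrite /decay; apply/andP; split.
  by rewrite divr_ge0 //; lra.
by rewrite ler_pdivrMr; lra.
Qed.

Lemma decay_expR : decay lam = expR (- (3 * cconst lam)).
Proof.
have s1 := sqrt_gt1; rewrite /cconst -/(normc2 lam); set s := Num.sqrt _ in s1 *.
rewrite mulrA divff ?mul1r ?expRN ?lnK ?posrE ?divr_gt0 ?invf_div //; lra.
Qed.

Lemma cconst_ge0 : 0 <= cconst lam.
Proof.
have := decay_itv; rewrite decay_expR => /andP[_].
by rewrite -[leRHS]expR0 ler_expR; lra.
Qed.

(** Each power of [decay] is worth [exp (- 3 c)], and [6 m >= d - 20] makes [3 c m] at least
    [c (d - 20) / 2]. *)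
Lemma decay_le (d m : nat) : (d <= 6 * m + 20)%N ->
  decay lam ^+ m <= expR (- (cconst lam * (d%:R - 20) / 2)).
Proof.
move=> dm; rewrite decay_expR -expRM_natl ler_expR.
have : d%:R <= 6 * m%:R + 20 :> R.
  by rewrite -[6]/(6%:R) -[20]/(20%:R) -natrM -natrD ler_nat.
have := cconst_ge0; set c := cconst lam; move: (d%:R) (m%:R) => x y c0 h.
have := mulr_ge0 c0 (_ : 0 <= 6 * y + 20 - x); nra.
Qed.

End Decay.

Lemma tiles_len_nseq t n : tiles_len (nseq n t) = (n * size (word t))%N.
Proof. by elim: n => [//|n IH]; rewrite [nseq _ _]/= tiles_len_cons IH mulSn. Qed.

(** * From observables on [X] and [Y] to the two sides of the cut *)

Section Locality.
Variables (R : realType) (N : nat).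
Implicit Types (X : {set 'I_N}) (ws : seq (R[i] * seq (bool * 'I_N))).

Lemma in_CAR_parP p X (A : op R N) : in_CAR_par p X A ->
  exists ws, [/\ A = lincomb ws, all (fun w => all (fun l => l.2 \in X) w.2) ws &
    has_parity p ws].
Proof.
by case=> ws [h ->]; exists ws; split => //; apply: sub_all h => w /andP[].
Qed.

Lemma left_localP i j T1 ws : (j < tiles_len T1)%N ->
  all (fun w => all (fun l => l.2 \in site_interval N i j) w.2) ws -> left_local T1 ws.
Proof.
by move=> h; apply: sub_all => w; apply: sub_all => l /=; rewrite inE /=; lia.
Qed.

Lemma right_localP i j T1 T2 t ws : (tiles_len T1 + tiles_len (t :: T2) <= i)%N ->
  all (fun w => all (fun l => l.2 \in site_interval N i j) w.2) ws ->
  right_local T1 T2 t ws.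
Proof.
by move=> h; apply: sub_all => w; apply: sub_all => l /=; rewrite inE /=; lia.
Qed.

Lemma lincomb_id : lincomb [:: (1, [::])] = @opid R N.
Proof. by apply/funext => psi; apply/funext => S; rewrite /lincomb big_seq1 mul1r. Qed.

End Locality.

Theorem theorem1p5 (R : realType) (N : nat) (i1 i2 j1 j2 : nat)
  (hX : (i1 <= i2 < N)%N) (hY : (j1 <= j2 < N)%N)
  (hdist : (20 <= sdist (site_interval N i1 i2) (site_interval N j1 j2))%N)
  (T : seq tile) (hT : root_tiling N T)
  (lam : R[i]) (hlam : lam != 0) (kappa : R) (hkappa : 0 < kappa) :
  let X := site_interval N i1 i2 in
  let Y := site_interval N j1 j2 in
  (forall A1 A2 : op R N, in_CAR_even X A1 -> in_CAR_even Y A2 ->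
     Normc.normc (omega lam T (opmul A1 A2) - omega lam T A1 * omega lam T A2)
     <= 8 * opnorm A1 * opnorm A2
          * expR (- (cconst lam * ((sdist X Y)%:R - 20) / 2)))
  /\
  (forall A1 A2 : op R N, in_CAR_odd X A1 -> in_CAR Y A2 ->
     omega lam T (opmul A1 A2) = 0 /\ omega lam T A1 = 0).

Proof.
move=> X Y; set d := sdist X Y in hdist *.
have TN : tiles_len T = N by case: hT.
(* A middle part of [n] monomers has [3 n] sites, and [3 n >= d - 11], hence [n] exceeds
   [(d - 12) %/ 3]. This exponent still suffices for [decay_le] because [d >= 20]. *)
have dle : (d <= 6 * ((d - 12) %/ 3) + 20)%N by lia.
have mn i j t T2 : (i + d <= j)%N -> (j <= i + tiles_len (t :: T2) + 11)%N ->
    forall n, t :: T2 = nseq n Mono -> ((d - 12) %/ 3 < n)%N.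
  by move=> h1 h2 n e; move: h2; rewrite e tiles_len_nseq /=; lia.
have fin (n1 n2 : R) : 0 <= n1 -> 0 <= n2 ->
    n1 * n2 * (8 * decay lam ^+ ((d - 12) %/ 3)) <=
    8 * n1 * n2 * expR (- (cconst lam * (d%:R - 20) / 2)).
  move=> p1 p2; rewrite [leLHS]mulrCA mulrA [8 * (n1 * n2)]mulrA ler_wpM2l //.
    by rewrite !mulr_ge0.
  exact: decay_le.
have [h|h] : (i2 + d <= j1)%N \/ (j2 + d <= i1)%N by apply: sdist_interval; rewrite // -/d; lia.
  have [|T1 [t [T2 [T3 [TE l1 l2 l3]]]]] := @tiling_split T i2 j1; first by rewrite TN; lia.
  have TN' : tiles_len (T1 ++ (t :: T2) ++ T3) = N by rewrite -TE.
  split=> A1 A2.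
    move=> /in_CAR_parP[ws [-> hl hp]] /in_CAR_parP[ws' [-> hr hp']].
    apply: le_trans (fin _ _ (opnorm_ge0 _) (opnorm_ge0 _)); rewrite TE.
    by have [] := decorrelation TN' (left_localP l1 hl) hp (right_localP l2 hr) hp'
      (mn _ _ _ _ h l3) (decay_itv hlam).
  move=> /in_CAR_parP[ws [-> hl hp]] [ws' [hr ->]]; rewrite /omega /opmul TE.
  rewrite (odd_left_zero lam TN' (left_localP l1 hl) hp (right_localP l2 hr)) mul0r.
  (* The single expectation is the product case with the identity as second observable. *)
  have := @odd_left_zero _ _ lam _ _ _ _ TN' ws [:: (1, [::])] (left_localP l1 hl) hp isT.
  by rewrite lincomb_id /opid => ->; rewrite mul0r.
have [|T1 [t [T2 [T3 [TE l1 l2 l3]]]]] := @tiling_split T j2 i1; first by rewrite TN; lia.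
have TN' : tiles_len (T1 ++ (t :: T2) ++ T3) = N by rewrite -TE.
split=> A1 A2.
  move=> /in_CAR_parP[ws [-> hr hp]] /in_CAR_parP[ws' [-> hl hp']].
  apply: le_trans (fin _ _ (opnorm_ge0 _) (opnorm_ge0 _)); rewrite TE.
  (* Now [X] lies to the right of [Y], so the right-local factor comes first in the product: this is
     the second half of [decorrelation]. *)
  have [_] := decorrelation TN' (left_localP l1 hl) hp' (right_localP l2 hr) hp
    (mn _ _ _ _ h l3) (decay_itv hlam).
  by rewrite [omega _ _ _ * _]mulrC [opnorm _ * opnorm _]mulrC.
move=> /in_CAR_parP[ws [-> hr hp]] [ws' [hl ->]]; rewrite /omega /opmul TE.
rewrite (odd_right_zero lam TN' (right_localP l2 hr) hp (left_localP l1 hl)) mul0r.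
have := @odd_right_zero _ _ lam _ _ _ _ TN' ws [:: (1, [::])] (right_localP l2 hr) hp isT.
by rewrite lincomb_id /opid => ->; rewrite mul0r.
Qed.
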